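(* Let $t$ be a positive integer and let $G$ be a connected simple graph of order $n\geq 9t+3$ with minimum degree $\delta(G)\geq t$. If $\eta(G)\leq \eta\big(K_t\vee(K_{n-2t}\cup tK_1)\big)$, then $G$ has a spanning tree with leaf distance at least four.
   Context: For a connected graph $G$ with vertices $v_1,\dots,v_n$, let $\mathcal{D}(G)$ be the distance matrix ($(i,j)$-entry is the distance between $v_i$ and $v_j$), let $tr(v_i)=\sum_j d(v_i,v_j)$ be the transmission of $v_i$, and let $\mathcal{Q}(G)=\mathrm{diag}(tr(v_1),\dots,tr(v_n))+\mathcal{D}(G)$ be the distance signless Laplacian matrix; $\eta(G)$ denotes the largest eigenvalue of $\mathcal{Q}(G)$. $K_m$ is the complete graph on $m$ vertices, $tK_1$ is $t$ isolated vertices, $\cup$ is disjoint union, and $G_1\vee G_2$ is the join (disjoint union plus all edges between $V(G_1)$ and $V(G_2)$). The leaf distance of a tree is the minimum distance in the tree between two distinct leaves (vertices of degree one). *)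

(* Defs.v *)
From HB Require Import structures.
From mathcomp Require Import all_boot all_order all_algebra.
From mathcomp Require Import boolp classical_sets reals.

Set Implicit Arguments.
Unset Strict Implicit.
Unset Printing Implicit Defensive.

Import Order.TTheory GRing.Theory Num.Theory.

Record sgraph (V : finType) := SGraph {
  adj :> rel V;
  adj_sym : symmetric adj;
  adj_irr : irreflexive adj }.

Section Graphs.
Variable V : finType.
Implicit Types (G H : sgraph V) (x y : V).

Definition connected_graph G := forall x y, connect G x y.

Definition walk_of_length G x y (k : nat) : bool :=
  [exists p : k.-tuple V, path G x p && (last x p == y)].

(* The least length of a walk from x to y; it takes the junk value #|V| when  *)
(* y is not reachable from x.                                                 *)
Definition dist G x y : nat := find (walk_of_length G x y) (iota 0 #|V|).

Lemma dist_walk G x y : connect G x y -> walk_of_length G x y (dist G x y).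
Proof.
move=> /connectP[p0 p0G ->]; case/shortenP: p0G => p pG Up _.
have szp : size p < #|V| by rewrite -[(size p).+1]/(size (x :: p)) -(card_uniqP Up) max_card.
have hasw : has (walk_of_length G x (last x p)) (iota 0 #|V|).
  apply/hasP; exists (size p); first by rewrite mem_iota.
  by apply/existsP; exists (in_tuple p); rewrite pG eqxx.
have := nth_find 0 hasw; rewrite nth_iota //.
by move: hasw; rewrite has_find size_iota.
Qed.

Lemma dist_min G x (p : seq V) : path G x p -> dist G x (last x p) <= size p.
Proof.
move=> pG; case: (ltnP (size p) #|V|) => szp; last first.
  by apply: leq_trans szp; rewrite -[leqRHS](size_iota 0) find_size.
rewrite leqNgt; apply/negP => /(before_find 0); rewrite nth_iota // add0n.
by move/existsP; apply; exists (in_tuple p); rewrite pG eqxx.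
Qed.

Definition degree G x : nat := #|[set y | G x y]|.

(* Degrees are smaller than #|V|, so the default of the minimum is only       *)
(* reached when V is empty.                                                   *)
Definition min_degree G : nat := \big[minn/#|V|]_(x : V) degree G x.

Definition transmission G x : nat := \sum_(y : V) dist G x y.

Definition acyclic G := forall c : seq V, 2 < size c -> ~ ucycle G c.

Definition is_tree G := connected_graph G /\ acyclic G.

Definition spanning_tree G H := is_tree H /\ subrel H G.

Definition leaf G x : bool := degree G x == 1.

(* A tree with at least two vertices has two distinct leaves, at distance     *)
(* smaller than #|V|, so the default is then not reached.                     *)
Definition leaf_distance G : nat :=
  \big[minn/#|V|]_(p : V * V | [&& leaf G p.1, leaf G p.2 & p.1 != p.2])
     dist G p.1 p.2.

End Graphs.

Section Constructions.

Lemma complete_sym m : symmetric (fun i j : 'I_m => i != j).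
Proof. by move=> i j; rewrite eq_sym. Qed.
Lemma complete_irr m : irreflexive (fun i j : 'I_m => i != j).
Proof. by move=> i; rewrite eqxx. Qed.
Definition complete m : sgraph 'I_m :=
  SGraph (@complete_sym m) (@complete_irr m).

Lemma edgeless_sym m : symmetric (fun _ _ : 'I_m => false).
Proof. by []. Qed.
Lemma edgeless_irr m : irreflexive (fun _ _ : 'I_m => false).
Proof. by []. Qed.
Definition edgeless m : sgraph 'I_m :=
  SGraph (@edgeless_sym m) (@edgeless_irr m).

(* [cross] decides adjacency between the two summands: [false] gives the      *)
(* disjoint union and [true] the join.                                        *)
Variables (V W : finType) (G : sgraph V) (H : sgraph W).

Definition sum_adj (cross : bool) (a b : V + W) : bool :=
  match a, b with
  | inl x, inl y => G x y
  | inr x, inr y => H x y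
  | _, _ => cross
  end.

Lemma sum_adj_sym cross : symmetric (sum_adj cross).
Proof. by move=> [x|x] [y|y] //=; apply: adj_sym. Qed.
Lemma sum_adj_irr cross : irreflexive (sum_adj cross).
Proof. by move=> [x|x] /=; apply: adj_irr. Qed.

Definition disjoint_union : sgraph (V + W)%type :=
  SGraph (sum_adj_sym false) (sum_adj_irr false).
Definition join : sgraph (V + W)%type :=
  SGraph (sum_adj_sym true) (sum_adj_irr true).

End Constructions.

Section DistanceSignlessLaplacian.
Local Open Scope ring_scope.
Local Open Scope classical_set_scope.
Variables (R : realType) (V : finType) (G : sgraph V).

Definition distance_mx : 'M[R]_#|V| :=
  \matrix_(i, j) (dist G (enum_val i) (enum_val j))%:R.

Definition transmission_mx : 'M[R]_#|V| :=
  diag_mx (\row_i (transmission G (enum_val i))%:R).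

Definition distance_signless_laplacian : 'M[R]_#|V| :=
  transmission_mx + distance_mx.

(* The matrix is real symmetric, so for nonempty V its set of eigenvalues is  *)
(* finite and nonempty, and this supremum is its maximum.                     *)
Definition eta : R :=
  sup [set a : R | eigenvalue distance_signless_laplacian a].

End DistanceSignlessLaplacian.

(* Main.v *)
(* A spanning tree of leaf distance at least four is obtained in one of two ways.

   If every nonempty independent set Y has more than |Y| neighbors, Hall's
   theorem gives a permutation s moving every vertex to a neighbor, whose
   cycles may be taken to be transpositions ("pairs") or odd.  One joins these
   cycles by links, any set of links being kept a forest modulo the cycles.
   Breaking each odd cycle at a suitable edge is harmless, so the only
   obstruction is a link between two stems, a stem being a vertex whose partner
   carries no link.  If a maximal obstruction-free forest is not spanning,
   adding one link to it yields forests all of whose bad links meet a single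
   stem; the set I of the partners ("exposed" vertices) of these stems
   satisfies N(I) <= s(I), as one sees by adding a link at an exposed vertex and
   deleting a link of the cycle it closes.  This contradicts the expansion
   hypothesis unless I = V, which is impossible because the bound on eta(G)
   forces some vertex to have more than n/2 neighbors.

   Otherwise some set S leaves at least |S| >= t isolated vertices in G - S, and
   Rayleigh quotients give eta(G) > eta(K_t v (K_{n-2t} u tK_1)) unless |S| = t
   and G is that join, which has a Hamiltonian path. *)
From mathcomp Require Import boolp classical_sets.
From mathcomp Require Import all_boot fingroup perm all_order all_algebra.
From mathcomp Require Import reals.
Require Import Defs.
From mathcomp Require Import zify ring lra.

Set Implicit Arguments.
Unset Strict Implicit.
Unset Printing Implicit Defensive.

Import Order.TTheory GRing.Theory Num.Theory.

(** * Links between the cycles of a permutation *)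

(** Every leaf of the final tree hangs on its image under the injective map [s], so two leaves never
    share a neighbor; the real danger is distance three, an edge between the neighbors of two
    leaves, which is a link between two stems. Odd cycles are harmless by parity: linked and
    unlinked vertices cannot alternate all the way around, and any irregularity is a place to break
    the cycle. An even cycle may offer no such place, hence the transpositions. A vertex with more
    than n/2 neighbors excludes I = V because it is adjacent to both vertices of some pair, and the
    obstructions to an exchange at these two contradict each other. On the spectral side one bound,
    8n/3 - 4 for the extremal graph, does most of the work: the all-ones vector gives 3n - 4 when no
    degree exceeds n/2, and a two-valued vector settles |S| >= n/8. It cannot decide the equality
    case |S| = t, so for smaller S the Perron vector of the extremal graph is transplanted to G. *)

Lemma set2_eqE (T : finType) (a b c d : T) :
  ([set a; b] == [set c; d]) = (a == c) && (b == d) || (a == d) && (b == c).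
Proof.
apply/eqP/idP => [eqS | /orP[] /andP[/eqP-> /eqP->] //]; last exact: setUC.
have := set21 a b; have := set22 a b; have := set21 c d; have := set22 c d.
rewrite {1 2}eqS -{1 2}eqS !inE.
by do 4 (case/orP => /eqP ?); subst; rewrite ?eqxx ?orbT.
Qed.

Section Connect.
Variables (T : finType) (e : rel T).
Hypothesis e_sym : symmetric e.

Lemma connectC x y : connect e x y = connect e y x.
Proof. exact: (sym_connect_sym e_sym). Qed.

(** A walk can be shortened so as to use the new edge at most once; the cases record whether it
    does, and in which direction. *)
Lemma connect_add_edge (e' : rel T) a b x y :
    (forall u v, e' u v -> [\/ e u v, u = a /\ v = b | u = b /\ v = a]) ->
  connect e' x y ->
  [\/ connect e x y, connect e x a /\ connect e b y
    | connect e x b /\ connect e a y].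
Proof.
move=> e'P /connectP[p + ->{y}].
elim/last_ind: p => [|p z IHp] /=; first by move=> _; constructor 1.
rewrite rcons_path last_rcons => /andP[/IHp{}IHp /e'P].
move: IHp; set u := last x p; case=> [xu|[xa bu]|[xb au]].
- case=> [uz|[ua ->]|[ub ->]].
  + by constructor 1; apply: connect_trans (connect1 uz).
  + by constructor 2; rewrite -ua connect0.
  + by constructor 3; rewrite -ub connect0.
- case=> [uz|[ua ->]|[ub ->]].
  + by constructor 2; split=> //; apply: connect_trans (connect1 uz).
  + by constructor 2; rewrite connect0.
  + by constructor 1.
- case=> [uz|[ua ->]|[ub ->]].
  + by constructor 3; split=> //; apply: connect_trans (connect1 uz).
  + by constructor 1.
  + by constructor 3; rewrite connect0.
Qed.

Lemma connect_crossing (e' : rel T) x y :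
    connect e' x y -> ~~ connect e x y ->
  exists a b, e' a b /\ ~~ connect e a b.
Proof.
move=> e'xy nexy.
have [/existsP[a /existsP[b /andP[e'ab neab]]]|nex] :=
  boolP [exists a, exists b, e' a b && ~~ connect e a b]; first by exists a, b.
case/negP: nexy; move: e'xy; apply: connect_sub => a b e'ab.
apply: contraNT nex => neab; apply/existsP; exists a; apply/existsP; exists b.
by rewrite e'ab.
Qed.

End Connect.

Section Links.
Variables (V : finType) (G : sgraph V) (s : {perm V}).
Hypothesis sG : forall v, G v (s v).
Implicit Types (E F : {set {set V}}) (u v w x y z p q a b : V).

Definition link E : rel V := fun v w => [set v; w] \in E.

Definition base E : rel V := fun v w => [|| link E v w, w == s v | v == s w].

(** Contracting the cycles of [s] turns the links into a forest; in particular no link has both ends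
    on one cycle. *)
Definition forest E :=
  forall v w, link E v w -> G v w && ~~ connect (base (E :\ [set v; w])) v w.

Definition linked E v := [exists w, link E v w].
Definition paired v := s (s v) == v.
(* In the final tree a paired vertex without links is a leaf, and its partner is
   the neighbor of that leaf. *)
Definition stem E v := paired v && ~~ linked E (s v).
Definition bad E v w := [&& link E v w, stem E v & stem E w].
Definition good E := forest E /\ forall v w, ~~ bad E v w.
(* [p] is exposed: any link attached to it removes all obstructions. *)
Definition near E p :=
  [/\ forest E, paired p, ~~ linked E p
    & forall v w, bad E v w -> v = s p \/ w = s p].

Lemma neqG v w : G v w -> v != w.
Proof. by apply: contraTneq => ->; rewrite adj_irr. Qed.

Lemma neqs v : v != s v.
Proof. exact: neqG. Qed.

Lemma linkC E v w : link E v w = link E w v.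
Proof. by rewrite /link setUC. Qed.

Lemma base_sym E : symmetric (base E).
Proof. by move=> v w; rewrite /base linkC orbCA orbA orbC orbA orbC. Qed.

Lemma linkedP E v : reflect (exists w, link E v w) (linked E v).
Proof. exact: existsP. Qed.

Lemma link_linked E v w : link E v w -> linked E v.
Proof. by move=> vw; apply/linkedP; exists w. Qed.

Lemma base_link E v w : link E v w -> base E v w.
Proof. by rewrite /base => ->. Qed.

Lemma base_s E v : base E v (s v).
Proof. by rewrite /base eqxx orbT. Qed.

Lemma paired_s v : paired (s v) = paired v.
Proof. by rewrite /paired (inj_eq perm_inj). Qed.

Lemma pairedK v : paired v -> s (s v) = v.
Proof. by move/eqP. Qed.

Lemma link_sub E F : E \subset F -> subrel (link E) (link F).
Proof. by move=> /subsetP EF v w; apply: EF. Qed.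

Lemma base_sub E F : E \subset F -> subrel (base E) (base F).
Proof.
by move=> EF v w; rewrite /base => /orP[/(link_sub EF)->|->] //; rewrite orbT.
Qed.

Lemma connect_base_sub E F v w :
  E \subset F -> connect (base E) v w -> connect (base F) v w.
Proof. by move=> EF; apply: connect_sub => a b /(base_sub EF)/connect1. Qed.

Lemma linkU E a b v w :
  link ([set a; b] |: E) v w =
  [|| (v == a) && (w == b), (v == b) && (w == a) | link E v w].
Proof. by rewrite /link in_setU1 set2_eqE orbA. Qed.

Lemma linkD E a b v w :
  link (E :\ [set a; b]) v w =
  ~~ ((v == a) && (w == b) || (v == b) && (w == a)) && link E v w.
Proof. by rewrite /link in_setD1 set2_eqE. Qed.

Lemma forest_sub E F : E \subset F -> forest F -> forest E.
Proof.
move=> EF fF v w /(link_sub EF)/fF/andP[-> /=]; apply: contra.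
by apply: connect_base_sub; apply: setSD.
Qed.

Lemma link_irr E v : forest E -> link E v v = false.
Proof. by move=> fE; apply/negP => /fE; rewrite adj_irr. Qed.

Lemma link_s E v : forest E -> link E v (s v) = false.
Proof.
by move=> fE; apply/negP => /fE/andP[_ /negP[]]; apply/connect1/base_s.
Qed.

Lemma base_setU E a b v w : base ([set a; b] |: E) v w ->
  [\/ base E v w, v = a /\ w = b | v = b /\ w = a].
Proof.
rewrite /base linkU => /orP[/or3P[]|->]; last by rewrite orbT; constructor 1.
- by case/andP=> /eqP-> /eqP->; constructor 2.
- by case/andP=> /eqP-> /eqP->; constructor 3.
- by move=> ->; constructor 1.
Qed.

(** A detour around an older link {v, w} would run through {a, b}; closed up by {v, w}, it would
    connect a to b without the new link. *)
Lemma forest_add E a b : forest E -> G a b -> ~~ connect (base E) a b ->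
  forest ([set a; b] |: E).
Proof.
move=> fE Gab nab v w.
have [|nE] := boolP ([set v; w] == [set a; b]).
  move=> /eqP eqvw _; rewrite eqvw.
  have sub : ([set a; b] |: E) :\ [set a; b] \subset E.
    by apply/subsetP=> X; rewrite !inE => /andP[/negPf->].
  move/eqP: eqvw; rewrite set2_eqE => /orP[] /andP[/eqP-> /eqP->].
    by rewrite Gab /=; apply: contra nab; apply: connect_base_sub.
  rewrite adj_sym Gab /=; apply: contra nab; rewrite (connectC (@base_sym E)).
  exact: connect_base_sub.
rewrite /link in_setU1 (negPf nE) /= => Evw.
have /andP[-> nvw] /= := fE v w Evw.
have -> : ([set a; b] |: E) :\ [set v; w] = [set a; b] |: (E :\ [set v; w]).
  apply/setP=> X; rewrite !inE; case: eqP => // ->.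
  by case: eqP => // eqX; rewrite eqX eqxx in nE.
apply/negP => /(connect_add_edge (@base_setU _ a b)).
have sub : E :\ [set v; w] \subset E by apply: subD1set.
have Bvw : connect (base E) v w by apply/connect1/base_link.
have CE := connectC (@base_sym E).
case=> [/(negP nvw)//|[va bw]|[vb aw]]; case/negP: nab.
  apply: (@connect_trans _ _ v); first by rewrite CE (connect_base_sub sub).
  by apply: (connect_trans Bvw); rewrite CE (connect_base_sub sub).
apply: (@connect_trans _ _ w); first exact: (connect_base_sub sub).
apply: (@connect_trans _ _ v); first by rewrite CE.
exact: (connect_base_sub sub).
Qed.

End Links.

(** * Exchanging links at an exposed vertex *)

Section Step.
Variables (V : finType) (G : sgraph V) (s : {perm V}).
Hypothesis sG : forall v, G v (s v).
Implicit Types (E F : {set {set V}}) (u v w x y z p q a b : V).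
Local Notation link := (@link V).
Local Notation base := (@base V s).
Local Notation forest := (@forest V G s).
Local Notation paired := (@paired V s).
Local Notation stem := (@stem V s).
Local Notation bad := (@bad V s).
Local Notation good := (@good V G s).
Local Notation near := (@near V G s).

(** A simple path passes y and z only once, so both halves survive the deletion of {y, z}. *)
Lemma path_cut E a l1 y z l2 :
    path (base E) a (l1 ++ z :: l2) -> last a l1 = y ->
    uniq (a :: l1 ++ z :: l2) ->
  connect (base (E :\ [set y; z])) a y /\
  connect (base (E :\ [set y; z])) z (last z l2).
Proof.
move=> + yl uq; rewrite cat_path /= => /and3P[p1 _ p2].
have ya : y \in a :: l1 by rewrite -yl mem_last.
move: uq; rewrite -cat_cons cat_uniq => /and3P[_ /hasPn disj _].
have zl1 : z \notin a :: l1 by apply: disj; rewrite mem_head.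
have yl2 : y \notin z :: l2 by apply: contraL ya => /disj.
split; apply/connectP.
  exists l1 => //; apply: (@sub_in_path _ (fun c => c != z)) p1; last first.
    by apply/allP => c cl; apply: contraNneq zl1 => <-.
  move=> c d cz dz; rewrite /base linkD.
  by rewrite (negPf (cz : c != z)) (negPf (dz : d != z)) /= !andbF.
exists l2 => //; apply: (@sub_in_path _ (fun c => c != y)) p2; last first.
  by apply/allP => c cl; apply: contraNneq yl2 => <-.
move=> c d cy dy; rewrite /base linkD.
by rewrite (negPf (cy : c != y)) (negPf (dy : d != y)) /= !andbF.
Qed.

(* What remains true when no exchange of links after adding {p, x} yields a good
   forest; the last two clauses rule out that both vertices of a pair are stuck. *)
Definition stuck E p x :=
  [/\ paired x, exists F, near F (s x) /\ #|F| = #|E|,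
      forall v, link E (s x) v -> stem E v -> v = s p
    & [\/ exists v, [/\ link E x v, stem E v & v != s p],
          linked E x && ~~ linked E (s x)
        | forall v, connect (base E) p v -> v \in [:: p; s p; x; s x]]].

Section Exchange.
Variables (E : {set {set V}}) (p x : V).
Hypotheses (fE : forest E) (pp : paired p) (pE : ~~ linked E p).
Hypothesis bE : forall v w, bad E v w -> v = s p \/ w = s p.
Hypotheses (Gpx : G p x) (xsp : x != s p).
Hypothesis xp : x != p.
Hypothesis has_bad : exists v w, bad E v w.

Lemma bad_at_sp : exists2 t, link E (s p) t & stem E t.
Proof.
have [v [w bvw]] := has_bad; have /and3P[vw Sv Sw] := bvw.
by case: (bE bvw) => <-; [exists w | exists v; rewrite // linkC].
Qed.

Lemma linked_sp : linked E (s p).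
Proof. by have [t /link_linked] := bad_at_sp. Qed.

Let U := [set p; x] |: E.

Lemma link_p v : link E p v = false.
Proof. by apply: contraNF pE; apply: link_linked. Qed.

Lemma stem_U v : stem U v -> [/\ stem E v, s v != p & s v != x].
Proof.
case/andP=> pv /negP uv; split.
- rewrite /stem pv /=; apply/negP => /linkedP[w svw]; apply: uv.
  by apply/linkedP; exists w; rewrite linkU svw !orbT.
- apply/eqP => svp; apply: uv; apply/linkedP; exists x.
  by rewrite linkU svp !eqxx.
- apply/eqP => svx; apply: uv; apply/linkedP; exists p.
  by rewrite linkU svx !eqxx orbT.
Qed.

(** Once p is linked, [s p] is no longer a stem, and every old bad link met [s p]. Only the forest
    property of [U] can fail. *)
Lemma nbad_U v w : ~~ bad U v w.
Proof.
apply/negP => /and3P[vw /stem_U[sv svp svx] /stem_U[sw swp swx]].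
have np a : stem E a -> a != p.
  by case/andP => _; apply: contraNneq => ->; apply: linked_sp.
move: vw; rewrite linkU (negPf (np v sv)) (negPf (np w sw)) /= andbF /= => vw.
have [] := bE (v := v) (w := w); first by apply/and3P.
  by move=> ev; case/eqP: svp; rewrite ev pairedK.
by move=> ev; case/eqP: swp; rewrite ev pairedK.
Qed.

Section Cut.
Variables (l1 l2 : seq V) (y z : V).
Hypothesis pth : path (base E) (s p) (l1 ++ z :: l2).
Hypotheses (yl : last (s p) l1 = y) (xl : last z l2 = x).
Hypothesis uq : uniq [:: p, s p & l1 ++ z :: l2].
Hypothesis yz : link E y z.

Let F := U :\ [set y; z].

Lemma y_neq_p : y != p.
Proof.
have /andP[pn _] := uq; apply: contraNneq pn => yp.
by rewrite -{1}yp -cat_cons mem_cat -yl mem_last.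
Qed.

Lemma z_neq_p : z != p.
Proof.
have /andP[pn _] := uq; apply: contraNneq pn => zp.
by rewrite -{1}zp inE mem_cat mem_head !orbT.
Qed.

(** Without {y, z} the vertex [s p] is still connected to y, and x to z, but y and z are separated;
    hence so are p and x. *)
Lemma forest_F : forest F.
Proof.
have uq' : uniq (s p :: l1 ++ z :: l2) by case/andP: uq.
have [c1 c2] := path_cut pth yl uq'.
have -> : F = [set p; x] |: (E :\ [set y; z]).
  apply/setP => X; rewrite /F /U !inE; case: (X =P [set p; x]) => //= ->.
  rewrite set2_eqE [p == y]eq_sym [p == z]eq_sym.
  by rewrite (negPf y_neq_p) (negPf z_neq_p).
apply: forest_add => //; first by apply: forest_sub fE; apply: subD1set.
have /andP[_] := fE yz; apply: contra => px.
have CE := connectC (@base_sym _ s (E :\ [set y; z])).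
apply: (@connect_trans _ _ (s p)); first by rewrite CE.
apply: (@connect_trans _ _ p); first by rewrite CE; apply/connect1/base_s.
by apply: (connect_trans px); rewrite CE -xl.
Qed.

Lemma card_F : #|F| = #|E|.
Proof.
have : #|U| = #|E|.+1.
  by rewrite cardsU1 -[_ \in E]/(link E p x) link_p.
rewrite (cardsD1 [set y; z]) /F.
have -> : [set y; z] \in U by rewrite inE -[[set y; z] \in E]/(link E y z) yz orbT.
by case.
Qed.

(* Under this condition all bad links of F meet the partner of [z]. *)
Definition safe := (exists v, link U y v /\ v != z) \/
  (forall v, link U (s y) v -> ~~ stem U v).

(** A vertex becomes a stem only when its partner loses its last link, and only y and z lose one. *)
Lemma stem_F v : stem F v -> ~~ stem U v ->
  (v = s y /\ ~~ linked F y /\ paired y) \/ (v = s z /\ ~~ linked F z /\ paired z).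
Proof.
case/andP=> pv nF; rewrite /stem pv /= negbK => /linkedP[t svt].
have : ~~ link F (s v) t by apply: contra nF => /link_linked.
rewrite linkD svt andbT negbK => /orP[] /andP[/eqP ev _]; [left|right];
  by rewrite -ev pairedK // paired_s.
Qed.

(** If [s y] is a new stem, y had no link but {y, z}, against the first case of [safe]. In the
    second case the links at [s y] lead to vertices that were not stems, so a bad one can only reach
    the other new stem [s z]. *)
Lemma bad_F v w : safe -> bad F v w ->
  [/\ paired z, ~~ linked F z & v = s z \/ w = s z].
Proof.
move=> sf; wlog nv : v w / ~~ stem U v => [WL bvw|].
  have [sv|/WL/(_ bvw)//] := boolP (stem U v).
  have [sw|nw] := boolP (stem U w).
    case/negP: (nbad_U v w); case/and3P: bvw => vw _ _; apply/and3P; split=> //.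
    exact: link_sub (subD1set _ _) _ _ vw.
  have [||pz nz vw] := WL w v => //; last by split=> //; case: vw; auto.
  by case/and3P: bvw => vw Sv Sw; apply/and3P; rewrite linkC.
case/and3P => vw /stem_F/(_ nv)[]; last by case=> -> [? ?] _; split=> //; left.
case=> ev [nFy py] Fw; case: sf => [[t [yt tz]]|nst].
  case/negP: nFy; apply/linkedP; exists t.
  have /andP[/neqG ynz _] := fE yz.
  by rewrite linkD yt (negPf tz) (negPf ynz) andbF.
have/nst nw : link U (s y) w by rewrite -ev; apply: link_sub vw; apply: subD1set.
case: (stem_F Fw nw); last by case=> -> [? ?]; split=> //; right.
by case=> ew _; move: vw; rewrite ev ew (link_irr _ forest_F).
Qed.

End Cut.

Lemma good_or_bad F : forest F -> #|F| = #|E| ->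
  (exists F, good F /\ #|F| = #|E|) \/ exists v w, bad F v w.
Proof.
move=> fF cF; have [/existsP[v /existsP[w bvw]]|nb] := boolP [exists v, exists w, bad F v w].
  by right; exists v, w.
left; exists F; split=> //; split=> // v w; apply: contra nb => bvw.
by apply/existsP; exists v; apply/existsP; exists w.
Qed.

(* Walk from [s p] to [x] along the cycle closed by {p, x}: if deleting the link
   {y, z} fails, then z has no other link, so the walk goes on to [s z] and the
   next link is again safe to delete on that side; on reaching [s z = x], the
   vertex [s x] has become exposed. *)
Lemma propagate n l1 l2 y z : size l2 < n ->
    path (base E) (s p) (l1 ++ z :: l2) -> last (s p) l1 = y ->
    last z l2 = x -> uniq [:: p, s p & l1 ++ z :: l2] -> link E y z ->
    ~~ stem U y -> safe y z ->
  (exists F, good F /\ #|F| = #|E|) \/ stuck E p x.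
Proof.
elim: n l1 l2 y z => // n IHn l1 l2 y z sz pth yl xl uq yz nsy sf.
pose F := U :\ [set y; z].
have fF : forest F by apply: forest_F pth yl xl uq yz.
have cF : #|F| = #|E| by apply: card_F.
have [?|[v [w bvw]]] := good_or_bad fF cF; first by left.
have badF a b : bad F a b -> [/\ paired z, ~~ linked F z & a = s z \/ b = s z].
  exact: (bad_F pth yl xl uq yz sf).
have [pz nFz szvw] := badF _ _ bvw.
have yp := y_neq_p yl uq; have zp := z_neq_p uq.
have /andP[/neqG ynz nyz] := fE yz.
have Uz t : link U z t -> t = y.
  move=> zt; apply: contraNeq nFz => ty; apply/linkedP; exists t.
  by rewrite linkD zt (negPf ty) [z == y]eq_sym (negPf ynz) andbF.
have Uyz : link U y z by rewrite linkU yz !orbT.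
have zx : z != x.
  apply: contra_neq yp => zx; apply/esym/Uz.
  by rewrite zx linkU !eqxx orbT.
case: l2 => [|c l2] in sz pth xl uq; first by rewrite -xl /= eqxx in zx.
have yc : y != c.
  have yin : y \in s p :: l1 by rewrite -yl mem_last.
  move: uq; rewrite cons_uniq -cat_cons cat_uniq => /and4P[_ _ /hasPn dis _].
  by apply: contraTneq yin => ->; apply: dis; rewrite !inE eqxx orbT.
have csz : c = s z.
  move: pth; rewrite cat_path /= => /and4P[_ _ + _].
  rewrite {1}/base => /or3P[zc|/eqP //|/eqP zsc]; last first.
    by apply/esym; rewrite zsc pairedK // -paired_s -zsc.
  case/eqP: yc; apply/esym/Uz; exact: link_sub (subsetUr _ _) _ _ zc.
subst c.
have [szx|szx] := eqVneq (s z) x.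
  right; have sxz : s x = z by rewrite -szx pairedK.
  have px : paired x by rewrite -szx paired_s.
  split=> //.
  - exists F; split=> //; rewrite sxz; split=> // a b /badF[_ _].
    by [].
  - rewrite sxz => t zt; have {t zt}-> : t = y.
      by apply: Uz; apply: link_sub (subsetUr _ _) _ _ zt.
    case/andP=> py; move: nsy; rewrite /stem py negbK /= => /linkedP[t].
    rewrite linkU => /or3P[/andP[/eqP syp _]|/andP[/eqP syx _]|syt].
    + by rewrite -syp pairedK.
    + by case/eqP: ynz; rewrite -sxz -syx pairedK.
    + by case/negP; apply/linkedP; exists t.
  have {v w bvw szvw}[t xt Ft] : exists2 t, link F x t & stem F t.
    case/and3P: bvw => vw Fv Fw; rewrite szx in szvw.
    by case: szvw => <-; [exists w | exists v; rewrite // linkC].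
  have Uxt : link U x t by apply: link_sub xt; apply: subD1set.
  (* The bad link at x is either an old link to an old stem, or {p, x} itself. In the latter case p
     is a stem of [F], so {y, z} was the only link of [s p], and the two pairs form a whole
     component. *)
  have [tp|tp] := eqVneq t p; last first.
    have Ext : link E x t by move: Uxt; rewrite linkU (negPf tp) (negPf xp) !andbF.
    have St : stem U t.
      apply/negPn/negP => nSt; case: (stem_F Ft nSt) => -[et _]; last first.
        by move: Ext; rewrite et szx (link_irr _ fE).
      case/negP: nyz; apply: (@connect_trans _ _ (s y)); first exact/connect1/base_s.
      apply: (@connect_trans _ _ x); apply: connect1; last by rewrite -szx base_sym base_s.
      apply: base_link; rewrite linkC linkD -et Ext andbT negb_or [x == z]eq_sym (negPf zx) /=.
      rewrite andbT; apply/negP => /andP[/eqP xy /eqP tz]; case/eqP: yc.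
      by rewrite szx xy.
    have [Et svp _] := stem_U St.
    constructor 1; exists t; split=> //.
    by apply: contra_neq svp => ->; rewrite pairedK.
  constructor 3; subst t; case/andP: Ft => _ nFsp.
  have Esp t : link E (s p) t -> s p = y /\ t = z.
    move=> spt; have : ~~ link F (s p) t by apply: contra nFsp => /link_linked.
    rewrite linkD (link_sub (subsetUr _ _) spt) andbT negbK.
    case/orP=> /andP[/eqP e1 /eqP e2]; first by [].
    by move: uq; rewrite -e1 /= mem_cat mem_head !orbT /= andbF.
  have [t /[dup] spt /Esp[spy tz] /andP[_ nEx]] := bad_at_sp.
  rewrite {t spt}tz szx in nEx.
  have cl : closed (base E) [:: p; s p; x; s x].
    apply: intro_closed; first by apply/sym_connect_sym/base_sym.
    move=> a b ab; rewrite !inE => ain.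
    have sab : (b == s a) || (a == s b) -> [|| b == p, b == s p, b == x | b == s x].
      have -> : (a == s b) = (s a == b).
        have /eqP {1}<- : paired a.
          by case/or4P: ain => /eqP ->; rewrite ?paired_s.
        exact: inj_eq perm_inj _ _.
      rewrite [s a == b]eq_sym orbb => /eqP ->.
      by case/or4P: ain => /eqP ->; rewrite ?pairedK ?eqxx ?orbT.
    case/orP: ab => // ab; case/or4P: ain => /eqP ea; subst a.
    - by rewrite link_p in ab.
    - by have [_ ->] := Esp _ ab; rewrite sxz eqxx !orbT.
    - by case/negP: nEx; apply: link_linked ab.
    - rewrite sxz in ab; have -> : b = y by apply: Uz; apply: link_sub (subsetUr _ _) _ _ ab.
      by rewrite -spy eqxx orbT.
  by move=> v /(closed_connect cl) <-; rewrite inE eqxx.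
case: l2 => [|z' l2] in sz pth xl uq; first by rewrite -xl /= eqxx in szx.
apply: (IHn (l1 ++ [:: z; s z]) l2 (s z) z') => //.
- by move: sz; rewrite /= ltnS => /ltnW.
- by rewrite -catA.
- by rewrite last_cat.
- by rewrite -catA.
- move: pth; rewrite cat_path /= => /and5P[_ _ _ + _].
  rewrite {1}/base => /or3P[//|/eqP ez|/eqP/perm_inj zz'].
    by move: uq; rewrite /= cat_uniq /= ez pairedK // !inE eqxx !orbT ?andbF.
  by move: uq; rewrite /= cat_uniq /= zz' !inE eqxx !orbT ?andbF.
- by rewrite /stem pairedK // (link_linked (w := y)) ?andbF // linkC.
(* The only link of z leads back to y, which is not a stem, so the next deletion is safe. *)
- by right=> t; rewrite pairedK // => /Uz ->.
Qed.

(** Here the first deletion is not safe: it takes the only link of [s p], which turns p into a stem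
    joined to the stem x. As {p, x} is then the only possible bad link, [s x] is exposed at once. *)
Lemma propagate_stem l2 z :
    path (base E) (s p) (z :: l2) -> last z l2 = x ->
    uniq [:: p, s p, z & l2] -> link E (s p) z ->
    (forall v, link U (s p) v -> v = z) -> stem U x -> connect (base E) p x ->
  stuck E p x.
Proof.
move=> pth xl uq spz Usp Ux px; pose F := U :\ [set s p; z].
have sUE := subsetUr [set [set p; x]] E.
have [Ex _ _] := stem_U Ux; have /andP[prx nUsx] := Ux.
have nEsx : ~~ linked E (s x) by case/andP: Ex.
have fF : forest F by apply: (forest_F (l1 := [::]) pth _ xl uq spz).
have linkF_xp : link F x p.
  by rewrite linkD linkU !eqxx orbT andbT (negPf xsp) (negPf (neqs sG p)) andbF.
have [t /[dup] spt /(link_sub sUE)/Usp tz /andP[pz nEsz]] := bad_at_sp.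
rewrite {t}tz in spt pz nEsz.
(* The path ends at z = x or leaves z by another link: [s z] is unlinked, so a path going there
   would end at [s z] = x, whose partner z is linked although x is a stem. *)
have linkFz : linked F z.
  have [->|zx] := eqVneq z x; first exact: link_linked linkF_xp.
  case: l2 => [|c l2] in pth xl uq; first by rewrite -xl /= eqxx in zx.
  case/and3P: pth => _ + pth; rewrite {1}/base => /orP[zc|].
    apply/linkedP; exists c; rewrite linkD (link_sub sUE zc) andbT.
    have /and4P[_ + _ _] := uq; rewrite !inE !negb_or => /and3P[spz' spc _].
    by rewrite [z == s p]eq_sym (negPf spz') [c == s p]eq_sym (negPf spc) andbF.
  have -> : (z == s c) = (c == s z).
    by rewrite -{1}(pairedK pz) (inj_eq perm_inj) eq_sym.
  rewrite orbb => /eqP csz.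
  case: l2 => [|d l2] in pth xl uq.
    by case/negP: nUsx; rewrite -xl /= csz pairedK //; apply: (link_linked (w := s p));
      rewrite linkC; apply: link_sub spz.
  case/andP: pth => + _; rewrite {1}/base csz => /or3P[szd|/eqP dz|/eqP/perm_inj dz].
  - by case/negP: nEsz; apply: link_linked szd.
  - by move: uq; rewrite dz pairedK // /= !inE eqxx !orbT !andbF.
  - by move: uq; rewrite dz /= !inE eqxx !orbT !andbF.
split=> //; last 1 first.
- constructor 2; rewrite nEsx andbT; apply: contraLR px => nEx.
  have cl : closed (base E) [:: x; s x].
    apply: intro_closed; first by apply/sym_connect_sym/base_sym.
    move=> a b ab; rewrite !inE => ain.
    have pa : paired a by case/orP: ain => /eqP ->; rewrite ?paired_s.
    case/or3P: ab => [ab|/eqP->|].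
    + case/orP: ain => /eqP ea; subst a; first by case/negP: nEx; apply: link_linked ab.
      by case/negP: nEsx; apply: link_linked ab.
    + by case/orP: ain => /eqP ->; rewrite ?pairedK ?eqxx ?orbT.
    + rewrite -{1}(pairedK pa) (inj_eq perm_inj) => /eqP <-.
      by case/orP: ain => /eqP ->; rewrite ?pairedK ?eqxx ?orbT.
  rewrite connectC; last exact: base_sym.
  apply/negP => /(closed_connect cl); rewrite inE eqxx !inE [p == x]eq_sym (negPf xp).
  by move=> /esym/eqP e; case/eqP: xsp; rewrite e pairedK.
- exists F; split; last by apply: card_F => //.
  split=> //; first by rewrite paired_s.
    apply: contra nUsx => /linkedP[v]; rewrite /F linkD => /andP[_].
    exact: link_linked.
  rewrite pairedK // => v w; wlog nv : v w / ~~ stem U v => [WL bvw|].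
    have [sv|/WL/(_ bvw)//] := boolP (stem U v).
    have [sw|nw] := boolP (stem U w).
      case/negP: (nbad_U v w); case/and3P: bvw => vw _ _; apply/and3P; split=> //.
      exact: link_sub (subD1set _ _) _ _ vw.
    have bwv : bad F w v by case/and3P: bvw => vw Sv Sw; apply/and3P; rewrite linkC.
    by case: (WL w v nw bwv); [right | left].
  case/and3P => vw /stem_F/(_ nv)[]; last by case=> _ [/negP].
  rewrite pairedK // => -[ev _] _; right; rewrite ev in vw.
  move: (link_sub (subD1set _ _) vw); rewrite linkU link_p eqxx orbF /=.
  by rewrite [p == x]eq_sym (negPf xp) orbF => /eqP.
- by move=> v sxv; case/negP: nEsx; apply: link_linked sxv.
Qed.

End Exchange.

Lemma step E p x : near E p -> G p x -> x != s p ->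
  (exists F, good F /\ #|E| <= #|F|) \/ stuck E p x /\ connect (base E) p x.
Proof.
case=> fE pp pE bE Gpx xsp; have xp : x != p by rewrite eq_sym (neqG Gpx).
have [[F [gF cF]]|has_bad] := good_or_bad fE (erefl #|E|).
  by left; exists F; rewrite cF.
have [px|npx] := boolP (connect (base E) p x); last first.
  left; exists ([set p; x] |: E); split; last by apply: subset_leq_card (subsetUr _ _).
  by split; [apply: forest_add | apply: nbad_U].
suff : (exists F, good F /\ #|F| = #|E|) \/ stuck E p x.
  by case=> [[F [gF <-]]|]; [left; exists F | right].
have [p0 pth0 xl0] := connectP px; case: (shortenP pth0) xl0 => p1 + + _ xl.
case: p1 xl => [xl _ _|c l xl]; first by rewrite xl eqxx in xp.
rewrite [path _ _ _]/= => /andP[pc pth] uq.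
have csp : c = s p.
  move: pc; rewrite {1}/base (link_p pE) /= -{2}(pairedK pp).
  by rewrite (inj_eq perm_inj) [s p == c]eq_sym orbb => /eqP.
rewrite {c pc}csp in pth uq xl.
case: l => [|z l2] in pth uq xl; first by rewrite xl eqxx in xsp.
have spz : link E (s p) z.
  case/andP: pth => + _; rewrite {1}/base => /or3P[//|/eqP zp|/eqP/perm_inj zp].
    by move: uq; rewrite zp pairedK // /= !inE eqxx !orbT.
  by move: uq; rewrite -zp /= !inE eqxx !orbT.
set U := [set p; x] |: E.
have Usp_p : link U p x by rewrite linkU !eqxx.
have nUsp : ~~ stem U (s p).
  by rewrite /stem pairedK // (link_linked Usp_p) andbF.
have go : safe E p x (s p) z -> (exists F, good F /\ #|F| = #|E|) \/ stuck E p x.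
  move=> sf; have sz : size l2 < (size l2).+1 by [].
  apply: (propagate _ _ _ bE Gpx xp has_bad sz (l1 := [::]) pth _ _ uq spz nUsp sf) => //.
(* The first deletion is safe if [s p] has a second link, or if x, the only vertex linked to p, is
   not a stem of [U]. *)
have [/existsP[v /andP[spv vz]]|nex] := boolP [exists v, link U (s p) v && (v != z)].
  by apply: go; left; exists v.
have Usp v : link U (s p) v -> v = z.
  by move=> spv; apply: contraNeq nex => vz; apply/existsP; exists v; rewrite spv.
have [Ux|nUx] := boolP (stem U x); last first.
  apply: go; right=> v; rewrite pairedK // linkU (link_p pE) eqxx orbF /=.
  by rewrite [p == x]eq_sym (negPf xp) orbF => /eqP ->.
right; apply: (propagate_stem _ _ _ _ _ _ _ _ pth) => //.
Qed.

End Step.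

(** * A maximal obstruction-free forest spans *)

Definition neighbors (V : finType) (G : sgraph V) (Y : {set V}) : {set V} :=
  [set w | [exists v in Y, G v w]].

Lemma neighborsP (V : finType) (G : sgraph V) (Y : {set V}) w :
  reflect (exists2 v, v \in Y & G v w) (w \in neighbors G Y).
Proof. by rewrite inE; apply: exists_inP. Qed.

Definition independent (V : finType) (G : sgraph V) (Y : {set V}) :=
  forall v w, v \in Y -> w \in Y -> ~~ G v w.

Section Connected.
Variables (V : finType) (G : sgraph V) (s : {perm V}).
Hypothesis sG : forall v, G v (s v).
Implicit Types (E F : {set {set V}}) (u v w x y z p q a b : V).
Local Notation link := (@link V).
Local Notation base := (@base V s).
Local Notation forest := (@forest V G s).
Local Notation paired := (@paired V s).
Local Notation stem := (@stem V s).
Local Notation bad := (@bad V s).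
Local Notation good := (@good V G s).
Local Notation near := (@near V G s).

(** Otherwise x and [s x] are both stuck. A neighbor y of p outside {[s p], x, [s x]} would be
    connected to p as well, which excludes a component consisting of two pairs; each remaining
    alternative for x contradicts those for [s x]. *)
Lemma good_of_pair E p x : near E p -> 4 <= degree G p ->
    G p x -> G p (s x) -> x != s p ->
  exists F, good F /\ #|E| <= #|F|.
Proof.
move=> nE deg4 Gpx Gpsx xsp; have [fE pp pE bE] := nE.
have sxsp : s x != s p by rewrite (inj_eq perm_inj) eq_sym (neqG Gpx).
case: (step sG nE Gpx xsp) => // -[st1 _].
case: (step sG nE Gpsx sxsp) => // -[st2 _].
have [px _ C2 C13] := st1; have [_ _ _ C13'] := st2.
rewrite pairedK // in C13'.
have [y] : exists y, y \in [set y | G p y] :\: [set s p; x; s x].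
  apply/set0Pn; rewrite -card_gt0 cardsD subn_gt0.
  apply: leq_trans deg4; apply: leq_ltn_trans (subset_leq_card (subsetIr _ _)) _.
  rewrite -setUA !cardsU1 cards1; case: (_ \notin _); by case: (_ \notin _).
rewrite !inE !negb_or => /andP[/andP[/andP[ysp yx] ysx] Gpy].
case: (step sG nE Gpy ysp) => // -[_ py].
have yp : y != p by rewrite eq_sym (neqG Gpy).
case: C13 => [[v [xv _ _]]||/(_ _ py)]; last first.
- by rewrite !inE (negPf yp) (negPf ysp) (negPf yx) (negPf ysx).
- move=> /andP[xE nsxE]; case: C13' => [[v [sxv _ _]]|/andP[sxE _]|/(_ _ py)].
  + by case/negP: nsxE; apply: link_linked sxv.
  + by rewrite sxE in nsxE.
  + by rewrite !inE (negPf yp) (negPf ysp) (negPf yx) (negPf ysx).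
- case: C13' => [[w [sxw Ew wsp]]|/andP[_]|/(_ _ py)].
  + by case/eqP: wsp; apply: C2.
  + by rewrite (link_linked xv).
  + by rewrite !inE (negPf yp) (negPf ysp) (negPf yx) (negPf ysx).
Qed.

Hypothesis G_conn : connected_graph G.
Hypothesis expand : forall Y, Y != set0 -> independent G Y ->
  #|Y| < #|neighbors G Y|.

Lemma good_connected u : #|V| < (degree G u).*2 -> 4 <= degree G u ->
  exists2 E, good E & forall x y, connect (base E) x y.
Proof.
move=> degu deg4.
have good0 : good set0.
  by split=> v w; rewrite /bad /link inE.
pose P E := boolp.asbool (good E).
have [E0 /boolp.asboolP gE0 maxE0] : exists2 E, P E & forall F, P F -> #|F| <= #|E|.
  have P0 : P set0 by apply/boolp.asboolP.
  by case: (@arg_maxnP _ set0 P (fun E => #|E|) P0) => E PE maxE; exists E.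
have max F : good F -> #|F| <= #|E0| by move=> /boolp.asboolP; apply: maxE0.
exists E0 => // a0 w0; apply/negPn/negP => naw0.
have [a [w [Gaw naw]]] := connect_crossing (G_conn a0 w0) naw0.
have [fE0 bE0] := gE0.
(* No good forest has #|E0| + 1 links, so every exchange at a member of [I] ends stuck. *)
pose Q p := boolp.asbool (exists E, near E p /\ #|E| = #|E0|.+1).
pose I := [set p | Q p].
have InI p : reflect (exists E, near E p /\ #|E| = #|E0|.+1) (p \in I).
  by rewrite inE; apply: boolp.asboolP.
have paI p : p \in I -> paired p by case/InI => E [[]].
have NI p x : p \in I -> G p x -> s x \in I /\ paired x.
  move=> pI Gpx; have [xsp|xsp] := eqVneq x (s p).
    by rewrite xsp paired_s pairedK ?paI.
  have /InI[E [nE cE]] := pI.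
  case: (step sG nE Gpx xsp) => [[F [/max]]|[[px [F [nF cF]] _ _] _]].
    by rewrite cE => leF /leq_trans/(_ leF); rewrite ltnn.
  by split=> //; apply/InI; exists F; rewrite cF.
have [p0 p0I] : exists p0, p0 \in I.
  pose E1 := [set a; w] |: E0.
  have fE1 : forest E1 by apply: forest_add.
  have cE1 : #|E1| = #|E0|.+1.
    rewrite cardsU1 -[_ \in E0]/(link E0 a w); case: (boolP (link _ _ _)) => // /base_link.
    by move=> /(_ s)/connect1; rewrite (negPf naw).
  case: (good_or_bad fE1 (erefl _)) => [[F [/max + cF]]|[v [z /and3P[vz Sv Sz]]]].
    by rewrite cF cE1 ltnn.
  have sub t : stem E1 t -> stem E0 t.
    case/andP=> pt nt; apply/andP; split=> //; apply: contra nt => /linkedP[r tr].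
    by apply/linkedP; exists r; apply: link_sub tr; apply: subsetUr.
  have St : stem E1 a.
    move: vz; rewrite linkU => /or3P[/andP[/eqP<- _]|/andP[_ /eqP<-]|vz] //.
    by case/negP: (bE0 v z); apply/and3P; split=> //; apply: sub.
  have /andP[pa nsa] := St.
  exists (s a); apply/InI; exists E1; split=> //; split=> //; first by rewrite paired_s.
  move=> v' z' /and3P[vz' Sv' Sz']; rewrite pairedK //.
  move: vz'; rewrite linkU => /or3P[/andP[/eqP-> _]|/andP[_ /eqP->]|vz']; auto.
  by case/negP: (bE0 v' z'); apply/and3P; split=> //; apply: sub.
(* The members of [I] with partner outside [I] form an independent set whose neighbors lie in its
   image under [s]; by expansion it is empty. *)
have sI p : p \in I -> s p \in I.
  pose Y := [set p in I | s p \notin I].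
  have [Y0|Yn0] := eqVneq Y set0.
    move=> pI; apply: contraT => spI; have : p \in Y by rewrite inE pI.
    by rewrite Y0 inE.
  have NY p' x : p' \in Y -> G p' x -> x \in [set s y | y in Y].
    rewrite inE => /andP[pI spI] Gpx; have [sxI px] := NI _ _ pI Gpx.
    rewrite -(pairedK px); apply: imset_f; rewrite inE sxI pairedK //=.
    apply: contra spI => xI; have Gxp : G x p' by rewrite adj_sym.
    by have [] := NI _ _ xI Gxp.
  have : #|Y| < #|neighbors G Y|.
    apply: expand => // v z vY zY; apply/negP => /(NY _ _ vY) /imsetP[y yY zsy].
    move: zY yY; rewrite !inE zsy => /andP[syI _] /andP[_].
    by rewrite syI.
  rewrite ltnNge => /negP[]; rewrite -(card_imset Y (@perm_inj _ s)).
  apply: subset_leq_card; apply/subsetP => x /neighborsP[v vY].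
  exact: NY vY.
have IV x : x \in I.
  have cl : closed G I.
    apply: intro_closed; first by apply/sym_connect_sym/adj_sym.
    by move=> p y Gpy /NI/(_ Gpy)[/sI + py]; rewrite pairedK.
  by rewrite -(closed_connect cl (G_conn p0 x)).
have /InI[E [nE cE]] := IV u.
(* [A] and its image under [s] both avoid u and [s u], and 2|A| > n - 2, so they meet: u is adjacent
   to both vertices of a pair. *)
pose A := [set x | G u x] :\ s u.
have [x xA sxA] : exists2 x, x \in A & s x \in A.
  have [/existsP[x /andP[xA sxA]]|nex] := boolP [exists x, (x \in A) && (s x \in A)].
    by exists x.
  have cA : (degree G u).-1 <= #|A|.
    rewrite /degree (cardsD1 (s u) [set y | G u y]) -/A.
    by case: (s u \in _); rewrite ?add1n ?leq_pred.
  have uA : u \notin A by rewrite !inE adj_irr andbF.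
  have suA : s u \notin A by rewrite !inE eqxx.
  have : #|A :|: [set s x | x in A]| <= #|~: [set u; s u]|.
    apply: subset_leq_card; apply/subsetP => x; rewrite !inE negb_or => /orP[/andP[-> Gux]|].
      by rewrite andbT eq_sym (neqG Gux).
    case/imsetP=> y yA ->; rewrite (inj_eq perm_inj).
    apply/andP; split; last by apply: contraNneq uA => <-.
    by apply: contraNneq suA => <-; rewrite pairedK ?paI.
  rewrite cardsU.
  have -> : A :&: [set s x | x in A] = set0.
    apply/setP => x; rewrite inE [RHS]inE; apply/negP => /andP[xA /imsetP[y yA xsy]].
    by case/negP: nex; apply/existsP; exists y; rewrite yA -xsy.
  rewrite cards0 subn0 (card_imset _ (@perm_inj _ s)).
  by move: (cardsC [set u; s u]) degu deg4 cA; rewrite cards2 (neqs sG); clear; lia.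
move: xA sxA; rewrite !inE => /andP[xsu Gux] /andP[_ Gusx].
have [F [/max]] := good_of_pair nE deg4 Gux Gusx xsu.
by rewrite cE => leF /leq_trans/(_ leF); rewrite ltnn.
Qed.

End Connected.

(** * Trees *)
Lemma connect_invariant (T : finType) (e : rel T) (P : pred T) x y :
  (forall a b, P a -> e a b -> P b) -> connect e x y -> P x -> P y.
Proof.
move=> Pe /connectP[p + ->{y}]; elim: p x => //= z p IHp x /andP[xz zp] Px.
by apply: IHp zp _; apply: Pe xz.
Qed.

Section Trees.
Variables (V : finType) (H : sgraph V).

Definition del_edge x y : rel V := fun a b => H a b && ([set a; b] != [set x; y]).

Lemma del_edge_sym x y : symmetric (del_edge x y).
Proof. by move=> a b; rewrite /del_edge adj_sym setUC. Qed.

Lemma del_edgeC x y : del_edge x y = del_edge y x.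
Proof. by rewrite /del_edge [[set x; y]]setUC. Qed.

Lemma acyclic_bridges :
  (forall x y, H x y -> ~~ connect (del_edge x y) x y) -> acyclic H.
Proof.
move=> br [//|x [//|y [//|z r]]] _ /andP[].
rewrite /= rcons_path => /and4P[xy yz pr zx] uq.
case/negP: (br x y xy); rewrite connectC; last exact: del_edge_sym.
have pyz : path H y (z :: r) by rewrite /= yz.
have [xr yr] : x \notin [:: y, z & r] /\ y \notin z :: r by case/and3P: uq.
have p1 : path (del_edge x y) y (z :: r).
  apply: (@sub_in_path _ (fun a => a != x)) pyz; last first.
    by apply/allP => a ar; apply: contraNneq xr => <-.
  move=> a b ax bx ab; rewrite /del_edge ab set2_eqE.
  by rewrite (negPf (ax : a != x)) (negPf (bx : b != x)) andbF.
apply: (@connect_trans _ _ (last z r)); first by apply/connectP; exists (z :: r).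
apply: connect1; rewrite /del_edge zx set2_eqE eqxx andbT.
rewrite [x == y]eq_sym negb_or negb_and.
have -> : last z r != y by apply: contraNneq yr => <-; apply: mem_last.
by rewrite andbT; apply/orP; right; apply: contraNneq xr => <-; rewrite mem_head.
Qed.

Lemma leaf_uniq v a b : leaf H v -> H v a -> H v b -> a = b.
Proof.
move=> /cards1P[c eqc] va vb.
have : a \in [set c] by rewrite -eqc inE.
have : b \in [set c] by rewrite -eqc inE.
by rewrite !inE => /eqP-> /eqP->.
Qed.

Lemma leaf_distance_geq m : m <= #|V| ->
    (forall v w, leaf H v -> leaf H w -> v != w -> m <= dist H v w) ->
  m <= leaf_distance H.
Proof.
move=> mV mdist; rewrite /leaf_distance; elim/big_ind: _ => //.
  by move=> a b; rewrite leq_min => -> ->.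
by case=> v w /and3P[]; apply: mdist.
Qed.

(** Distance 1 would make [f v] a leaf, distance 2 would identify [f v] with [f w], and distance 3
    would make them adjacent. *)
Lemma leaf_distance_geq4 (f : V -> V) : 3 < #|V| -> connected_graph H ->
    injective f -> (forall v w, leaf H v -> H v w -> w = f v) ->
    (forall v, leaf H v -> ~~ leaf H (f v)) ->
    (forall v w, leaf H v -> leaf H w -> ~~ H (f v) (f w)) ->
  3 < leaf_distance H.
Proof.
move=> V4 Hc fI Hf lf lff; apply: leaf_distance_geq => // v w lv lw vw.
have /existsP[[p /= /eqP szp] /andP[pth /eqP lp]] := dist_walk (Hc v w).
rewrite -szp leqNgt; apply/negP => sp.
case: p {szp} pth lp sp => /= [_ vw0|a p /andP[/(Hf _ _ lv) ->]].
  by rewrite vw0 eqxx in vw.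
case: p => /= [_ fvw|b p /andP[fvb]]; first by move: (lf v lv); rewrite fvw lw.
case: p => /= [_ bw|c p /andP[bc]].
  move: fvb; rewrite bw adj_sym => /(Hf _ _ lw)/fI e.
  by rewrite e eqxx in vw.
case: p => /= [_ cw|//].
move: bc; rewrite cw adj_sym => /(Hf _ _ lw) e.
by move: fvb; rewrite e (negPf (lff _ _ lv lw)).
Qed.

End Trees.

(** * Hamiltonian paths as spanning trees *)

Section HamiltonianPath.
Variables (V : finType) (G : sgraph V) (x : V) (p : seq V).
Hypotheses (pG : path G x p) (up : uniq (x :: p)).
Hypotheses (allp : forall y, y \in x :: p) (V5 : 4 < #|V|).

Let pos y := index y (x :: p).
Let trace a b := (pos a == (pos b).+1) || (pos b == (pos a).+1).

Lemma trace_sym : symmetric trace.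
Proof. by move=> a b; rewrite /trace orbC. Qed.
Lemma trace_irr : irreflexive trace.
Proof. by move=> a; rewrite /trace orbb; lia. Qed.

Let H := SGraph trace_sym trace_irr.

Lemma size_ham : (size p).+1 = #|V|.
Proof.
rewrite -[(size p).+1]/(size (x :: p)) -(card_uniqP up).
by apply: eq_card => y; rewrite allp.
Qed.

Lemma pos_lt y : pos y < #|V|.
Proof. by rewrite -size_ham -[(size p).+1]/(size (x :: p)) index_mem. Qed.

Lemma nth_pos y : nth x (x :: p) (pos y) = y.
Proof. exact: nth_index. Qed.

Lemma pos_nth i : i < #|V| -> pos (nth x (x :: p) i) = i.
Proof. by move=> iV; rewrite /pos index_uniq // [size _]/= size_ham. Qed.

Lemma pos_inj : injective pos.
Proof. by move=> a b eqp; rewrite -[a]nth_pos eqp nth_pos. Qed.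

Lemma trace_sub : subrel H G.
Proof.
have suc a b : pos b = (pos a).+1 -> G a b.
  move=> e; have /pathP-/(_ x (pos a)) := pG.
  have -> : nth x p (pos a) = b by rewrite -[b]nth_pos e.
  rewrite nth_pos; apply.
  by have := pos_lt b; rewrite e -size_ham ltnS.
by move=> a b /orP[] /eqP /suc //; rewrite adj_sym.
Qed.

Lemma trace_connected : connected_graph H.
Proof.
suff cx y : connect H x y.
  move=> a b; apply: (connect_trans _ (cx b)).
  by rewrite connectC //; apply: adj_sym.
move: {2}(pos y) (erefl (pos y)) => i; elim: i y => [|i IHi] y eqi.
  have -> : y = x by apply: pos_inj; rewrite eqi /pos /= eqxx.
  exact: connect0.
have iV : i < #|V| by apply: ltnW; rewrite -eqi pos_lt.
apply: (connect_trans (IHi _ (pos_nth iV))); apply: connect1.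
by rewrite /= /trace pos_nth // eqi eqxx orbT.
Qed.

(** The only leaves are the two ends, at distance #|V| - 1, since an edge changes the position by
    one. *)
Lemma hamiltonian_path_tree :
  exists T : sgraph V, spanning_tree G T /\ 4 <= leaf_distance T.
Proof.
exists H; split; first (split; last exact: trace_sub).
  split; first exact: trace_connected.
  apply: acyclic_bridges => a b ab.
  wlog {ab} ab : a b / pos b = (pos a).+1 => [WL|].
    case/orP: ab => /eqP; last exact: WL.
    by move=> /WL; rewrite connectC 1?del_edgeC //; apply: del_edge_sym.
  apply/negP => /(@connect_invariant _ _ (fun w => pos w <= pos a)).
  have inv c d : pos c <= pos a -> del_edge H a b c d -> pos d <= pos a.
    move=> ca /andP[/orP[]/eqP e ne]; first by lia.
    have [ca'|] := eqVneq (pos c) (pos a); last by lia.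
    case/eqP: ne; rewrite (pos_inj ca'); congr [set _; _].
    by apply: pos_inj; lia.
  by move=> /(_ inv (leqnn _)); rewrite ab ltnn.
have ends v : leaf H v -> pos v = 0 \/ pos v = #|V|.-1.
  move=> lv; have pV := pos_lt v.
  case: (posnP (pos v)) => [|p0]; [by left|right].
  apply/eqP; apply: contraT => pn.
  have h1 : (pos v).-1 < #|V| by lia.
  have h2 : (pos v).+1 < #|V| by lia.
  have H1 : trace v (nth x (x :: p) (pos v).-1) by rewrite /trace !pos_nth //; lia.
  have H2 : trace v (nth x (x :: p) (pos v).+1) by rewrite /trace !pos_nth //; lia.
  by have := congr1 pos (leaf_uniq lv H1 H2); rewrite !pos_nth //; lia.
have walk q a : path H a q -> pos (last a q) <= pos a + size q /\ pos a <= pos (last a q) + size q.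
  elim: q a => [|b q IHq] a /=; first by lia.
  by case/andP=> /orP[]/eqP e /IHq; lia.
apply: leaf_distance_geq; first exact: ltnW.
move=> v w /ends pv /ends pw vw.
have /existsP[[q /= /eqP szq] /andP[/walk + /eqP lq]] := dist_walk (trace_connected v w).
rewrite lq szq; have : pos v != pos w by apply: contra_neq vw => /pos_inj.
by case: pv pw => -> [] ->; lia.
Qed.

End HamiltonianPath.

(** * Opening the odd cycles *)

Section Cut.
Variables (V : finType) (G : sgraph V) (s : {perm V}).
Hypothesis sG : forall v, G v (s v).
Implicit Types (E F : {set {set V}}) (u v w x y z p q a b : V).
Local Notation link := (@link V).
Local Notation base := (@base V s).
Local Notation forest := (@forest V G s).
Local Notation paired := (@paired V s).
Local Notation stem := (@stem V s).
Local Notation bad := (@bad V s).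
Local Notation good := (@good V G s).

Lemma paired_iter n v : paired (iter n s v) = paired v.
Proof. by elim: n => //= n IHn; rewrite paired_s. Qed.

Lemma fconnect_base E v w : fconnect s v w -> connect (base E) v w.
Proof. by apply: connect_sub => a b /eqP <-; apply/connect1/base_s. Qed.

Variables (E : {set {set V}}) (cut : pred V).
Hypotheses (gE : good E) (cE : forall x y, connect (base E) x y) (V5 : 4 < #|V|).
(** Removing {r, [s r]} must not make r a leaf, so r carries a link. The other end [s r] may become
    a leaf, but then its neighbor [s (s r)] must be free of links. *)
Hypothesis cut_linked : forall r, cut r -> linked E r.
Hypothesis cut_next : forall r, cut r -> ~~ linked E (s r) -> ~~ linked E (s (s r)).
Hypothesis cut_ex : forall v, ~~ paired v -> exists2 r, fconnect s v r & cut r.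
Hypothesis cut_uniq : forall r r', cut r -> cut r' -> fconnect s r r' -> r = r'.

(* [cut r] removes the edge {r, s r} of an odd cycle. *)
Definition opened v w :=
  [|| link E v w, (w == s v) && ~~ cut v | (v == s w) && ~~ cut w].

Lemma opened_sym : symmetric opened.
Proof. by move=> v w; rewrite /opened linkC [X in _ || X]orbC. Qed.

Lemma opened_irr : irreflexive opened.
Proof.
by move=> v; rewrite /opened (link_irr _ gE.1) (negPf (neqs sG v)).
Qed.

Let H := SGraph opened_sym opened_irr.

Lemma opened_sub : subrel H G.
Proof.
move=> v w /or3P[/gE.1/andP[]//|/andP[/eqP-> _]|/andP[/eqP-> _]]; first exact: sG.
by rewrite adj_sym.
Qed.

Lemma opened_s v : ~~ cut v -> H v (s v).
Proof. by move=> nv; rewrite /= /opened eqxx nv orbT. Qed.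

(** Going around the cycle from [s v], no second removed edge is met before v. *)
Lemma connect_opened_s v : connect H v (s v).
Proof.
have [cv|/opened_s/connect1//] := boolP (cut v).
have ck k : connect H (s v) (iter k s (s v)).
  elim: k => // k IHk; have [cr|nr] := boolP (cut (iter k s (s v))); last first.
    by apply: (connect_trans IHk); apply/connect1/opened_s.
  rewrite iterS -(cut_uniq cv cr) ?connect0 //.
  by rewrite -iterSr; apply: fconnect_iter.
rewrite connectC; last exact: adj_sym.
have := ck (findex s (s v) v); rewrite iter_findex //.
by rewrite fconnect_sym ?fconnect1 //; apply: perm_inj.
Qed.

Lemma opened_connected : connected_graph H.
Proof.
move=> x y; move: (cE x y); apply: connect_sub => a b.
case/or3P=> [ab|/eqP->|/eqP->]; first by apply: connect1; rewrite /= /opened ab.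
  exact: connect_opened_s.
by rewrite connectC ?connect_opened_s //; apply: adj_sym.
Qed.

Lemma del_link x y : link E x y ->
  subrel (del_edge H x y) (base (E :\ [set x; y])).
Proof.
move=> xy a b /andP[]; rewrite set2_eqE /base linkD => ab -> /=.
by case/or3P: ab => [->|/andP[-> _]|/andP[-> _]]; rewrite ?orbT.
Qed.

(** After a first link, the rest of the path would lead back to the cycle of v, against the bridge
    property of that link. *)
Lemma s_step_path v (l : seq V) a : fconnect s v a -> uniq (a :: l) ->
    path (del_edge H v (s v)) a l -> last a l = s v ->
  path (fun c d => del_edge H v (s v) c d && ~~ link E c d) a l.
Proof.
elim: l a => //= z l IHl a va /andP[al ul] /andP[az pz] lz; rewrite az /=.
have naz : ~~ link E a z.
  apply/negP => linkaz; have /gE.1/andP[_ /negP] := linkaz; apply.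
  have fsv : fconnect s a (s v).
    rewrite fconnect_sym; last exact: perm_inj.
    by rewrite -(same_fconnect1 (@perm_inj _ s)).
  apply: (connect_trans (fconnect_base _ fsv)); rewrite connectC; last exact: base_sym.
  apply/connectP; exists l => //.
  apply: (@sub_in_path _ (fun c => c != a)) pz; last first.
    by apply/allP => c cl; apply: contraNneq al => <-.
  move=> c d ca da cd; apply: del_link => //.
  rewrite /del_edge; move: cd => /andP[-> _] /=.
  by rewrite set2_eqE (negPf (ca : c != a)) (negPf (da : d != a)) andbF.
rewrite naz /=; apply: IHl => //.
move: az; rewrite /del_edge /= /opened (negPf naz) /= => /andP[/orP[]/andP[/eqP e _] _].
  by rewrite e; apply: connect_trans va (fconnect1 _ _).
move: va; rewrite e fconnect_sym; last exact: perm_inj.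
by rewrite -(same_fconnect1 (@perm_inj _ s)) fconnect_sym //; apply: perm_inj.
Qed.

(** A detour stays on the cycle of v. A pair offers none; a longer cycle is opened at some r, and
    the segment from [s r] to v can only be left through {v, [s v]}. *)
Lemma opened_bridge_s v : ~~ cut v -> ~~ connect (del_edge H v (s v)) v (s v).
Proof.
move=> nv; apply/negP => /connectP[p0 pth0 lp0].
case: (shortenP pth0) lp0 => p pth up _ /esym lp.
have {pth} pth := s_step_path (connect0 _ _) up pth lp.
pose e a b := del_edge H v (s v) a b && ~~ link E a b.
have eE a b : e a b ->
    [set a; b] != [set v; s v] /\ (b = s a /\ ~~ cut a \/ a = s b /\ ~~ cut b).
  case/andP=> /andP[+ ne] nab; rewrite /= /opened (negPf nab) /= => /orP[]/andP[/eqP? ?].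
    by split=> //; left.
  by split=> //; right.
have csv : connect e v (s v) by apply/connectP; exists p.
have [pv|npv] := boolP (paired v).
  have inv a b : a == v -> e a b -> b == v.
    move=> /eqP-> /eE[/eqP ne [[bs _]|[vs _]]]; first by case: ne; rewrite bs.
    have bs : b = s v by rewrite vs pairedK // -paired_s -vs.
    by case: ne; rewrite bs.
  have := connect_invariant inv csv (eqxx v).
  by rewrite eq_sym (negPf (neqs sG v)).
have [r vr cr] := cut_ex npv.
have rv : exists m, iter m s (s r) == v.
  exists (findex s (s r) v); rewrite iter_findex //.
  rewrite -(same_fconnect1 (@perm_inj _ s)) fconnect_sym //; exact: perm_inj.
case: (ex_minnP rv) => m /eqP mv mmin.
pose P a := [exists i : 'I_m.+1, a == iter i s (s r)].
have inv a b : P a -> e a b -> P b.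
  case/existsP=> -[i im] /= /eqP ea /eE[ne [[bs na]|[as_ nb]]]; last first.
    case: i im ea => [|i] im ea.
      by move: nb; rewrite -(@perm_inj _ s r b) ?cr // -as_ ea.
    have ib : b = iter i s (s r) by apply: (@perm_inj _ s); rewrite -as_ ea.
    by apply/existsP; exists (Ordinal (ltnW im)); rewrite ib.
  have im' : i < m.
    rewrite ltn_neqAle -ltnS im andbT; apply: contraNneq ne => eim.
    by rewrite bs ea eim mv.
  by apply/existsP; exists (Ordinal (im' : i.+1 < m.+1)); rewrite bs ea.
have Pv : P v by apply/existsP; exists ord_max; rewrite /= mv.
have /existsP[[[|i] im] /= /eqP sv] := connect_invariant inv csv Pv.
  by move: nv; rewrite (@perm_inj _ s v r) ?cr.
have /eqP/mmin : iter i s (s r) = v by apply: (@perm_inj _ s); rewrite -sv.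
by rewrite leqNgt -ltnS im.
Qed.

Lemma opened_tree : is_tree H.
Proof.
split; first exact: opened_connected.
apply: acyclic_bridges => x y xy.
have [lxy|nlxy] := boolP (link E x y).
  have /gE.1/andP[_] := lxy; apply: contra; apply: connect_sub => a b ab.
  by apply/connect1/del_link.
move: xy; rewrite /= /opened (negPf nlxy) /= => /orP[]/andP[/eqP-> nc].
  exact: opened_bridge_s.
rewrite connectC; last exact: del_edge_sym.
by rewrite del_edgeC; apply: opened_bridge_s.
Qed.

(** Every vertex keeps a cycle edge, since no cycle is opened twice, so a leaf has no link besides.
    A leaf outside the pairs has lost the edge from its predecessor, because a cut vertex is linked;
    then [cut_next] applies. *)
Lemma leaf_opened v : leaf H v ->
  [/\ ~~ linked E v, forall w, H v w -> w = s v & ~~ paired v -> ~~ linked E (s v)].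
Proof.
move=> lv; pose v' := (s^-1)%g v.
have sv' : s v' = v by apply: permKV.
have nlv : ~~ linked E v.
  apply/negP => /linkedP[w vw].
  have Hvw : H v w by rewrite /= /opened vw.
  have [cv|/opened_s Hvs] := boolP (cut v).
    have ncv' : ~~ cut v'.
      apply/negP => cv'; have := neqs sG v'.
      by rewrite sv' (cut_uniq cv' cv) ?eqxx // -[X in fconnect _ _ X]sv' fconnect1.
    have Hvv' : H v v' by rewrite adj_sym -[X in H _ X]sv'; apply: opened_s.
    have e := leaf_uniq lv Hvw Hvv'.
    by move: vw; rewrite e linkC -[X in link _ _ X]sv' (link_s _ gE.1).
  by move: vw; rewrite (leaf_uniq lv Hvw Hvs) (link_s _ gE.1).
have Hvs : H v (s v) by apply: opened_s; apply: contra nlv => /cut_linked.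
split=> // [w Hvw|npv]; first exact: leaf_uniq lv Hvw Hvs.
have [cv'|/opened_s] := boolP (cut v').
  by rewrite -{1}sv'; apply: cut_next; rewrite ?sv'.
rewrite sv' adj_sym => /(leaf_uniq lv Hvs) e.
by move: npv; rewrite /paired e sv' eqxx.
Qed.

Lemma opened_leaf_distance : 3 < leaf_distance H.
Proof.
(* Two adjacent leaves would form a pair without links, a whole component of size two. *)
have lf v : leaf H v -> ~~ leaf H (s v).
  move=> lv; apply/negP => lsv; have [nv Hv _] := leaf_opened lv.
  have [nsv Hsv _] := leaf_opened lsv.
  have Hvs : H v (s v) by apply: opened_s; apply: contra nv => /cut_linked.
  have pv : paired v by apply/eqP/esym/Hsv; rewrite adj_sym.
  have inv a b : a \in [set v; s v] -> base E a b -> b \in [set v; s v].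
    rewrite !inE => av /or3P[ab|/eqP->|/eqP e].
    - by case/orP: av ab => /eqP-> /link_linked; rewrite (negPf nv, negPf nsv).
    - by case/orP: av => /eqP->; rewrite ?pairedK ?eqxx ?orbT.
    - case/orP: av => /eqP ea; last by rewrite (@perm_inj _ s b v) ?eqxx // -e.
      by rewrite (@perm_inj _ s b (s v)) ?eqxx ?orbT // -e ea pairedK.
  have : [set: V] \subset [set v; s v].
    by apply/subsetP => w _; apply: (connect_invariant inv (cE v w)); rewrite !inE eqxx.
  by move/subset_leq_card; rewrite cardsT cards2; case: (_ != _); lia.
apply: (@leaf_distance_geq4 _ H s) => //.
- exact: ltnW.
- exact: opened_connected.
- exact: perm_inj.
- by move=> v w /leaf_opened[_ Hv _] /Hv.
move=> v w lv lw; apply/negP.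
have [nv Hv npv] := leaf_opened lv; have [nw Hw npw] := leaf_opened lw.
case/or3P=> [vw|/andP[/eqP/perm_inj e _]|/andP[/eqP/perm_inj e _]]; last 2 first.
- by move: (lf v lv); rewrite -e lw.
- by move: (lf w lw); rewrite -e lv.
have pv : paired v.
  by apply/negPn/negP => /npv/negP; apply; apply: link_linked vw.
have pw : paired w.
  by apply/negPn/negP => /npw/negP; apply; rewrite linkC in vw; apply: link_linked vw.
case/negP: (gE.2 (s v) (s w)); rewrite /bad vw /stem .
by rewrite !paired_s !pairedK // pv pw nv nw.
Qed.

Lemma opened_spanning :
  exists T : sgraph V, spanning_tree G T /\ 4 <= leaf_distance T.
Proof.
exists H; split; last exact: opened_leaf_distance.
by split; [apply: opened_tree | apply: opened_sub].
Qed.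

End Cut.

Section OddCycles.
Variables (V : finType) (G : sgraph V) (s : {perm V}).
Hypothesis sG : forall v, G v (s v).
Hypothesis odd_cycles : forall v, paired s v \/ exists k, iter k.*2.+1 s v = v.
Hypothesis V5 : 4 < #|V|.

Lemma good_connected_tree (E : {set {set V}}) :
    good G s E -> (forall x y, connect (base s E) x y) ->
  exists T : sgraph V, spanning_tree G T /\ 4 <= leaf_distance T.
Proof.
move=> gE cE; have sI := @perm_inj _ s.
(* An odd cycle without links is a component of the base graph, hence a Hamiltonian cycle. *)
have [/existsP[v /andP[npv /forallP nlv]]|] :=
  boolP [exists v, ~~ paired s v && [forall w, fconnect s v w ==> ~~ linked E w]].
  have all_orbit w : fconnect s v w.
    apply: (connect_invariant _ (cE v w) (connect0 _ _)) => a b va.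
    case/or3P=> [ab|/eqP->|/eqP e].
    - by have := nlv a; rewrite va (link_linked ab).
    - exact: connect_trans va (fconnect1 _ _).
    - by apply: connect_trans va _; rewrite e fconnect_sym // fconnect1.
  have orbE w : w \in orbit s v by rewrite -fconnect_orbit.
  have := orbit_uniq s v; have := orbE.
  rewrite /orbit -orderSpred /= => allp up.
  apply: (hamiltonian_path_tree _ up allp V5).
  apply: (@sub_path _ (frel s)) (fpath_traject _ _ _) => a b /eqP <-.
  exact: sG.
rewrite negb_exists => /forallP lk.
pose ok r := linked E r && (linked E (s r) || ~~ linked E (s (s r))).
(* Otherwise each linked vertex is followed by an unlinked and then a linked one, which an odd cycle
   does not allow. *)
have ok_ex v : ~~ paired s v -> exists2 r, fconnect s v r & ok r.
  move=> npv; have := lk v; rewrite npv /= negb_forall => /existsP[a].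
  rewrite negb_imply negbK => /andP[va la].
  have [/existsP[r /andP[vr okr]]|/existsPn nok] := boolP [exists r, fconnect s v r && ok r].
    by exists r.
  have nokr r : fconnect s v r -> linked E r -> ~~ linked E (s r) /\ linked E (s (s r)).
    move=> vr lr; have := nok r; rewrite vr /ok lr /= negb_or negbK.
    by move/andP.
  have viter n : fconnect s v (iter n s a).
    by apply: connect_trans va _; apply: fconnect_iter.
  have even k : linked E (iter k.*2 s a).
    by elim: k => // k IHk; rewrite doubleS; have [] := nokr _ (viter k.*2) IHk.
  have npa : ~~ paired s a.
    by rewrite -(iter_findex va) paired_iter.
  case: (odd_cycles a) => [pa|[k ka]]; first by rewrite pa in npa.
  have := even k.+1; rewrite doubleS -[iter _ _ _]/(s (iter k.*2.+1 s a)) ka.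
  by have [/negPf->] := nokr _ (viter 0) la.
(* The choice sees only the orbit of v, so it is the same on a whole cycle. The default can be
   reached only on pairs, which [cut] excludes. *)
pose rep v := odflt v [pick r | fconnect s v r && ok r].
have repP v : ~~ paired s v -> fconnect s v (rep v) && ok (rep v).
  move=> npv; rewrite /rep; case: pickP => [r //|].
  by have [r vr okr] := ok_ex v npv => /(_ r); rewrite vr okr.
have rep_eq v w : ~~ paired s v -> fconnect s v w -> rep v = rep w.
  move=> npv vw; rewrite /rep.
  have e : (fun r => fconnect s v r && ok r) =1 (fun r => fconnect s w r && ok r).
    by move=> r; rewrite (same_connect (fconnect_sym sI) vw).
  rewrite (eq_pick e); case: pickP => // no.
  by have [r vr okr] := ok_ex v npv; have := no r; rewrite -e vr okr.
pose cut v := ~~ paired s v && (rep v == v).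
have cutok r : cut r -> ok r.
  by case/andP=> npr /eqP rr; have /andP[_] := repP r npr; rewrite rr.
apply: (@opened_spanning V G s sG E cut) => //.
- by move=> r /cutok /andP[].
- by move=> r /cutok /andP[_ /orP[->|]].
- move=> v npv; have /andP[vr okr] := repP v npv; exists (rep v) => //.
  have npr : ~~ paired s (rep v) by rewrite -(iter_findex vr) paired_iter.
  by rewrite /cut npr -(rep_eq v (rep v) npv vr) eqxx.
- move=> r r' /andP[npr /eqP er] /andP[_ /eqP er'] rr'.
  by rewrite -[LHS]er -[RHS]er'; apply: rep_eq.
Qed.

End OddCycles.

(** * Perfect 2-matchings *)
Section Hall.
Variables (V : finType) (r : rel V).

Definition rel_image (X : {set V}) : {set V} := [set y | [exists x in X, r x y]].

Lemma rel_imageP (X : {set V}) y : reflect (exists2 x, x \in X & r x y) (y \in rel_image X).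
Proof. by rewrite inE; apply: exists_inP. Qed.

Lemma rel_imageU (X Y : {set V}) : rel_image (X :|: Y) = rel_image X :|: rel_image Y.
Proof.
apply/setP => y; rewrite in_setU; apply/rel_imageP/orP => [[x]|].
  by rewrite in_setU => /orP[] xX xy; [left|right]; apply/rel_imageP; exists x.
by case=> /rel_imageP[x xX xy]; exists x; rewrite // inE xX ?orbT.
Qed.

(** A tight proper subset X is matched first, and the condition survives for the rest of A outside
    the image of X. Without a tight subset, any edge at a can be used and its ends removed. *)
Lemma hall_aux n (A B : {set V}) : #|A| <= n ->
    (forall X : {set V}, X \subset A -> #|X| <= #|rel_image X :&: B|) ->
  exists f : V -> V, {in A &, injective f} /\
    forall x, x \in A -> r x (f x) && (f x \in B).
Proof.
elim: n A B => [|n IHn] A B.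
  rewrite leqn0 cards_eq0 => /eqP-> _; exists id.
  by split=> [x y|x]; rewrite inE.
move=> cA hall; have [->|[a aA]] := set_0Vmem A.
  by exists id; split=> [x y|x]; rewrite inE.
have [/existsP[X /and4P[XA Xn0 XnA cX]]|tight] :=
  boolP [exists X : {set V}, [&& X \subset A, X != set0, X != A & #|rel_image X :&: B| <= #|X|]].
  have ltXA : #|X| < #|A| by apply: proper_card; rewrite properEneq XnA XA.
  have X0 : 0 < #|X| by rewrite card_gt0.
  have cAX : #|A :\: X| = #|A| - #|X| by rewrite cardsD (setIidPr XA).
  have [||f [finj fB]] := IHn X B; first by rewrite -ltnS (leq_trans ltXA).
    by move=> Y YX; apply: hall; apply: subset_trans XA.
  have [||g [ginj gB]] := IHn (A :\: X) (B :\: rel_image X).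
  - by rewrite cAX; lia.
  - move=> Y; rewrite subsetD => /andP[YA YX].
    have := hall (X :|: Y); rewrite subUset XA YA => /(_ isT).
    rewrite cardsU (disjoint_setI0 _) 1?disjoint_sym // cards0 subn0 rel_imageU.
    have -> : (rel_image X :|: rel_image Y) :&: B =
      (rel_image X :&: B) :|: (rel_image Y :&: (B :\: rel_image X)).
      apply/setP => y; rewrite !(in_setU, in_setI, in_setD).
      by case: (y \in rel_image X); case: (y \in rel_image Y); case: (y \in B).
    have [] := leq_card_setU (rel_image X :&: B) (rel_image Y :&: (B :\: rel_image X)).
    by move=> + _ => /[swap]/leq_trans/[apply]; move: cX; clear; lia.
  exists (fun x => if x \in X then f x else g x); split=> [x y xA yA|x xA].
    have gN z : z \in A -> z \notin X -> g z \notin rel_image X.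
      move=> zA zX; have := gB z; rewrite !inE zA zX => /(_ isT) /and3P[_ + _].
      by [].
    have fN z : z \in X -> f z \in rel_image X.
      by move=> zX; have /andP[rz _] := fB z zX; apply/rel_imageP; exists z.
    case: ifP => xX; case: ifP => yX.
    - exact: finj.
    - by move=> e; have := gN y yA (negbT yX); rewrite -e fN.
    - by move=> e; have := gN x xA (negbT xX); rewrite e fN.
    - by apply: ginj; rewrite inE ?xX ?yX.
  case: ifP => xX; first exact: fB.
  by have := gB x; rewrite !inE xA xX => /(_ isT) /and3P[-> _ ->].
have [b] : exists b, b \in rel_image [set a] :&: B.
  by apply/set0Pn; rewrite -card_gt0; apply: leq_trans (hall [set a] _); rewrite ?cards1 ?sub1set.
rewrite inE => /andP[/rel_imageP[a' /set1P-> rab] bB].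
have [||f [finj fB]] := IHn (A :\ a) (B :\ b).
- by move: cA; rewrite (cardsD1 a A) aA.
- move=> X XA; have [->|Xn0] := eqVneq X set0; first by rewrite cards0.
  have XA' : X \subset A by apply: subset_trans XA (subD1set _ _).
  have XnA : X != A by apply: contraTneq XA => ->; apply/subsetPn; exists a; rewrite // !inE eqxx.
  have := existsPn tight X; rewrite XA' Xn0 XnA /= -ltnNge => ltX.
  have -> : rel_image X :&: (B :\ b) = (rel_image X :&: B) :\ b.
    by apply/setP => y; rewrite !inE andbCA.
  by move: ltX; rewrite (cardsD1 b (rel_image X :&: B)); case: (b \in _); lia.
exists (fun x => if x == a then b else f x); split=> [x y xA yA|x xA].
  have fb z : z \in A -> z != a -> f z != b.
    by move=> zA za; have := fB z; rewrite !inE zA za => /(_ isT) /and3P[].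
  case: eqP => [->|/eqP xa]; case: eqP => [->|/eqP ya] //.
  - by move=> e; have := fb y yA ya; rewrite -e eqxx.
  - by move=> e; have := fb x xA xa; rewrite e eqxx.
  - by apply: finj; rewrite !inE ?xa ?ya.
case: eqP => [->|/eqP xa]; first by rewrite rab.
by have := fB x; rewrite !inE xA xa => /(_ isT) /and3P[-> _ ->].
Qed.

Lemma hall_perm : (forall X : {set V}, #|X| <= #|rel_image X|) ->
  exists s : {perm V}, forall v, r v (s v).
Proof.
move=> hall; have [||f [finj fr]] := @hall_aux #|V| setT setT.
- exact: max_card.
- by move=> X _; rewrite setIT.
have fI : injective f by move=> x y; apply: finj; rewrite inE.
by exists (perm fI) => v; rewrite permE; have /andP[] := fr v (in_setT v).
Qed.

End Hall.

(** * Splitting even cycles into transpositions *)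

Section OddPerm.
Variables (V : finType) (G : sgraph V) (s : {perm V}).
Hypothesis sG : forall v, G v (s v).

Let oddv v := boolp.asbool (exists k, iter k.*2.+1 s v = v).
(** Parity of the distance from the root of the cycle, a proper 2-coloring on even cycles only. *)
Let black v := boolp.asbool (exists k, iter k.*2 s (froot s v) = v).

Lemma oddv_s v : oddv (s v) = oddv v.
Proof.
apply/boolp.asboolP/boolp.asboolP => -[k ek]; exists k; last by rewrite -iterSr iterS ek.
by apply: (@perm_inj _ s); rewrite -iterS iterSr.
Qed.

Lemma oddv_iter n v : oddv (iter n s v) = oddv v.
Proof. by elim: n => //= n IHn; rewrite oddv_s. Qed.

Lemma froot_s v : froot s (s v) = froot s v.
Proof.
apply/esym/eqP; rewrite (root_connect (fconnect_sym (@perm_inj _ s))).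
exact: fconnect1.
Qed.

Lemma froot_iter v : exists i, iter i s (froot s v) = v.
Proof.
exists (findex s (froot s v) v); apply: iter_findex.
by rewrite fconnect_sym ?connect_root //; apply: perm_inj.
Qed.

Lemma black_s v : ~~ oddv v -> black (s v) = ~~ black v.
Proof.
move=> nodd.
have nroot : ~~ oddv (froot s v) by have [i ei] := froot_iter v; rewrite -ei oddv_iter in nodd.
have parity a b : iter a.*2 s (froot s v) <> iter b.*2.+1 s (froot s v).
  have iterI m x y : iter m s x = iter m s y -> x = y.
    by elim: m => //= m IHm /perm_inj.
  move=> e; case/negP: nroot; apply/boolp.asboolP.
  case: (leqP a b) => ab.
    exists (b - a); apply/esym; apply: (iterI a.*2); rewrite e.
    have -> : b.*2.+1 = a.*2 + (b - a).*2.+1 by lia.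
    exact: iterD.
  exists (a - b.+1); apply: (iterI b.*2.+1); rewrite -e.
  have -> : a.*2 = b.*2.+1 + (a - b.+1).*2.+1 by lia.
  by rewrite iterD.
apply/idP/idP => [/boolp.asboolP[k]|nb].
  rewrite froot_s => ek; apply/negP => /boolp.asboolP[l el].
  by apply: (parity k l); rewrite ek iterS el.
apply/boolp.asboolP; rewrite froot_s; have [i ei] := froot_iter v.
have oi : odd i.
  apply: contraNT nb => ev; apply/boolp.asboolP; exists i./2.
  by rewrite even_halfK.
exists (i./2).+1; have -> : (i./2).+1.*2 = i.+1.
  by rewrite doubleS -[in RHS](odd_double_half i) oi.
by rewrite iterS ei.
Qed.

(** On even cycles black vertices step forward and white ones back, which pairs them up; odd cycles
    are left alone. *)
Let f v := if oddv v || black v then s v else (s^-1)%g v.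

Lemma oddv_f v : oddv (f v) = oddv v.
Proof. by rewrite /f; case: ifP => _; rewrite ?oddv_s // -{2}[v](permKV s) oddv_s. Qed.

Lemma fK v : ~~ oddv v -> f (f v) = v.
Proof.
move=> nv; have [bv|/negPf bv] := boolP (black v).
  have -> : f v = s v by rewrite /f bv orbT.
  by rewrite /f oddv_s (negPf nv) black_s // bv /= permK.
have nw : ~~ oddv ((s^-1)%g v) by rewrite -oddv_s permKV.
have -> : f v = (s^-1)%g v by rewrite /f bv (negPf nv).
by have := black_s nw; rewrite permKV bv => /esym/negbFE bw; rewrite /f bw orbT permKV.
Qed.

Lemma f_inj : injective f.
Proof.
move=> v w e; have eo : oddv v = oddv w by rewrite -oddv_f e oddv_f.
have [ov|nv] := boolP (oddv v); last by rewrite -(fK nv) e fK // -eo.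
by move: e; rewrite /f -eo ov; apply: perm_inj.
Qed.

Lemma odd_perm_exists : exists s' : {perm V}, (forall v, G v (s' v)) /\
  forall v, paired s' v \/ exists k, iter k.*2.+1 s' v = v.
Proof.
exists (perm f_inj); split=> v.
  by rewrite permE /f; case: ifP => _ //; rewrite adj_sym -{2}[v](permKV s).
have [ov|nv] := boolP (oddv v); last by left; rewrite /paired !permE fK.
have /boolp.asboolP[k ek] := ov; right; exists k; rewrite -[RHS]ek.
elim: _.+1 => //= n ->; rewrite permE /f.
by rewrite oddv_iter ov.
Qed.

End OddPerm.

Theorem expanding_graph_tree (V : finType) (G : sgraph V) (u : V) :
    connected_graph G ->
    (forall Y : {set V}, Y != set0 -> independent G Y -> #|Y| < #|neighbors G Y|) ->
    4 < #|V| -> #|V| < (degree G u).*2 -> 4 <= degree G u ->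
  exists T : sgraph V, spanning_tree G T /\ 4 <= leaf_distance T.
Proof.
move=> Gc expand V5 degu deg4.
have [X|s0 s0G] := @hall_perm V G.
  (* Vertices of X with a neighbor in X lie in the image of X, and outside the neighborhood of [X1];
     so Hall's condition reduces to the independent set [X1]. *)
  pose X1 := [set x in X | [forall y in X, ~~ G x y]].
  have X1X : X1 \subset X by apply/subsetP => x; rewrite inE => /andP[].
  have le1 : #|X1| <= #|neighbors G X1|.
    have [->|n0] := eqVneq X1 set0; first by rewrite cards0.
    apply/ltnW/expand => // v w; rewrite !inE => /andP[_ /forall_inP vX] /andP[wX _].
    exact: vX.
  have sub : (X :\: X1) :|: neighbors G X1 \subset rel_image G X.
    apply/subsetP => y /setUP[|/neighborsP[x xX1 xy]]; last first.
      by apply/rel_imageP; exists x; rewrite // (subsetP X1X).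
    rewrite !inE => /andP[+ yX]; rewrite yX /= negb_forall_in => /exists_inP[x xX].
    by rewrite negbK => yx; apply/exists_inP; exists x; rewrite // adj_sym.
  apply: leq_trans (subset_leq_card sub); rewrite cardsU.
  have -> : (X :\: X1) :&: neighbors G X1 = set0.
    apply/setP => y; rewrite [RHS]inE; apply/negP => /setIP[/setDP[yX _]].
    case/neighborsP => x; rewrite inE => /andP[_ /forall_inP/(_ y yX)].
    by move/negP.
  by rewrite cards0 subn0 cardsD (setIidPr X1X); have := subset_leq_card X1X; lia.
have [s [sG os]] := odd_perm_exists s0G.
have [E gE cE] := good_connected sG Gc expand degu deg4.
exact: good_connected_tree os V5 E gE cE.
Qed.

(** * The largest eigenvalue *)
Local Open Scope ring_scope.


Section Rayleigh.
Variables (R : realType) (n : nat).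
Implicit Types (A M : 'M[R]_n) (x y : 'rV[R]_n).

Definition bil A x y : R := (x *m A *m y^T) 0 0.
Definition sqn x : R := (x *m x^T) 0 0.

Lemma sqnE x : sqn x = \sum_i x 0 i ^+ 2.
Proof. by rewrite /sqn mxE; apply: eq_bigr => i _; rewrite mxE expr2. Qed.

Lemma sqn_ge0 x : 0 <= sqn x.
Proof. by rewrite sqnE; apply: sumr_ge0 => i _; apply: sqr_ge0. Qed.

Lemma sqn_gt0 x : x != 0 -> 0 < sqn x.
Proof.
move=> x0; rewrite lt0r sqn_ge0 andbT; apply: contraNneq x0 => s0.
apply/eqP/rowP => i; rewrite mxE; apply/eqP.
move: s0; rewrite sqnE => /eqP; rewrite psumr_eq0 => [|j _]; last exact: sqr_ge0.
by move=> /allP/(_ i); rewrite mem_index_enum sqrf_eq0 => /(_ isT).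
Qed.

Lemma bil_bound A : exists2 C, 0 < C & forall x, bil A x x <= C * sqn x.
Proof.
exists (1 + \sum_i \sum_j `|A i j|) => [|x].
  by rewrite ltr_wpDr // sumr_ge0 // => i _; apply: sumr_ge0 => j _; apply: normr_ge0.
have xx i j : `|x 0 i * x 0 j| <= sqn x.
  have xi k : x 0 k ^+ 2 <= sqn x.
    by rewrite sqnE (bigD1 k) //= lerDl sumr_ge0 // => l _; apply: sqr_ge0.
  have := xi i; have := xi j; have := sqr_ge0 (x 0 i - x 0 j); have := sqr_ge0 (x 0 i + x 0 j).
  by rewrite ler_norml; nra.
rewrite mulrDl mul1r -[X in X <= _]add0r; apply: lerD; first exact: sqn_ge0.
have -> : bil A x x = \sum_i \sum_j x 0 i * A i j * x 0 j.
  rewrite /bil mxE exchange_big /=; apply: eq_bigr => j _.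
  by rewrite !mxE mulr_suml.
rewrite mulr_suml; apply: ler_sum => i _; rewrite mulr_suml; apply: ler_sum => j _.
apply: le_trans (ler_norm _) _; rewrite mulrAC normrM mulrC.
by apply: ler_wpM2l; rewrite ?normr_ge0.
Qed.

Lemma bilC A x y : A^T = A -> bil A x y = bil A y x.
Proof.
move=> sA; rewrite /bil -[in RHS](trmxK (y *m A *m x^T)) [in RHS]mxE.
by rewrite !trmx_mul trmxK sA mulmxA.
Qed.

Lemma bilDZ A t x y : A^T = A ->
  bil A (x + t *: y) (x + t *: y) = bil A x x + 2 * t * bil A x y + t ^+ 2 * bil A y y.
Proof.
move=> sA; have := bilC x y sA; rewrite /bil linearD /= linearZ /=.
rewrite !mulmxDl !mulmxDr -!scalemxAl -!scalemxAr !mxE => ->.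
by rewrite expr2; ring.
Qed.

(** The supremum mu of the Rayleigh quotients is an eigenvalue: mu I - A is positive semidefinite,
    and its inverse cannot exist. *)
Lemma symmetric_max_eigenvalue A : (0 < n)%N -> A^T = A ->
  exists2 mu, eigenvalue A mu & forall x, bil A x x <= mu * sqn x.
Proof.
move=> n0 sA; have [C C0 bC] := bil_bound A.
pose K : set R := fun r => exists2 x, x != 0 & r = bil A x x / sqn x.
have KC : ubound K C.
  by move=> r [x x0 ->]; rewrite ler_pdivrMr ?sqn_gt0 // bC.
have x1 : exists x : 'rV[R]_n, x != 0.
  exists (delta_mx 0 (Ordinal n0)); apply/eqP => /rowP/(_ (Ordinal n0)).
  by rewrite !mxE !eqxx => /eqP; rewrite oner_eq0.
have supK : has_sup K.
  by split; [have [x x0] := x1; exists (bil A x x / sqn x); exists x | exists C].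
pose mu := sup K; have mub x : bil A x x <= mu * sqn x.
  have [->|x0] := eqVneq x 0; first by rewrite /bil /sqn !mul0mx mxE mulr0.
  rewrite -ler_pdivrMr ?sqn_gt0 //; apply: sup_upper_bound => //.
  by exists x.
exists mu => //; pose M := mu%:M - A.
have sM : M^T = M by rewrite /M linearB /= tr_scalar_mx sA.
have bM x : bil M x x = mu * sqn x - bil A x x.
  by rewrite /bil /sqn /M mulmxBr mulmxBl mul_mx_scalar -scalemxAl !mxE.
have [uM|nuM] := boolP (M \in unitmx); last first.
  rewrite /eigenvalue /eigenspace kermx_eq0 row_free_unit.
  by rewrite -opprB -scaleN1r unitmxZ ?unitrN1.
(* If M were invertible, evaluating it at x - y / D with y M = x would show that
   mu is not the least upper bound. *)
have [D D0 bD] := bil_bound (invmx M).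
suff : mu <= mu - D^-1.
  have : 0 < D^-1 by rewrite invr_gt0.
  by lra.
apply: sup_le_ub => //; first by case: supK.
move=> r [x x0 ->]; have sx := sqn_gt0 x0; rewrite ler_pdivrMr //.
have [y yM yE] : exists2 y, y *m M = x & y = x *m invmx M.
  by exists (x *m invmx M); rewrite // mulmxKV.
have byx : bil M x y = sqn x by rewrite bilC // /bil yM.
have byy : bil M y y = bil (invmx M) x x.
  rewrite /bil yM -yE -[in RHS](trmxK (y *m x^T)) [in RHS]mxE.
  by rewrite trmx_mul trmxK.
have := bM (x + (- D^-1) *: y); have := mub (x + (- D^-1) *: y).
rewrite -subr_ge0 => h1 h2; rewrite -h2 bilDZ // byx byy bM in h1.
have := bD x; have Dn : D * D^-1 = 1 by rewrite divff ?gt_eqF.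
have Di : 0 < D^-1 by rewrite invr_gt0.
move: h1 Dn Di; set e := D^-1 => h1 Dn Di h3.
have : e ^+ 2 * bil (invmx M) x x <= e * sqn x.
  rewrite expr2 -mulrA ler_pM2l //.
  have -> : sqn x = e * (D * sqn x) by rewrite mulrA [e * D]mulrC Dn mul1r.
  by rewrite ler_pM2l.
move: h1; rewrite mulrBl sqrrN; nra.
Qed.

End Rayleigh.

Local Close Scope ring_scope.

(** * Distances and the quadratic form of the matrix *)

Section Distance.
Variables (V : finType) (G : sgraph V).

Lemma dist_walkP x y k : reflect (exists p, [/\ path G x p, last x p = y & size p = k])
  (walk_of_length G x y k).
Proof.
apply: (iffP existsP) => [[p /andP[pG /eqP <-]]|[p [pG <- szp]]].
  by exists p; rewrite size_tuple.
have /eqP e := szp; exists (Tuple e); rewrite /= pG eqxx //.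
Qed.

Lemma walk_of_lengthC x y k : walk_of_length G x y k = walk_of_length G y x k.
Proof.
wlog suff imp : x y / walk_of_length G x y k -> walk_of_length G y x k.
  by apply/idP/idP; apply: imp.
case/dist_walkP=> p [pG <- szp]; apply/dist_walkP; exists (rev (belast x p)).
split; last by rewrite size_rev size_belast.
  rewrite rev_path; apply: sub_path pG => a b; by rewrite adj_sym.
by case: p {pG szp} => //= a p; rewrite rev_cons last_rcons.
Qed.

Lemma distC x y : dist G x y = dist G y x.
Proof. by rewrite /dist; apply: eq_find => k; apply: walk_of_lengthC. Qed.

Lemma distxx x : dist G x x = 0%N.
Proof. by apply/eqP; rewrite -leqn0; apply: (@dist_min _ G x [::]). Qed.

Hypothesis Gc : connected_graph G.

Lemma dist_path x y : exists p, [/\ path G x p, last x p = y & size p = dist G x y].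
Proof. by apply/dist_walkP/dist_walk/Gc. Qed.

Lemma dist_gt0 x y : x != y -> 0 < dist G x y.
Proof.
by have [[|a p] [_ /= <- <-]] := dist_path x y; rewrite ?eqxx.
Qed.

Lemma dist_gt1 x y : x != y -> ~~ G x y -> 1 < dist G x y.
Proof.
have [[|a [|b p]] [/= xp <- <-]] := dist_path x y; rewrite ?eqxx //.
by case/andP: xp => ->.
Qed.

Lemma dist1_adj x y : dist G x y = 1%N -> G x y.
Proof.
have [xy|nxy] := eqVneq x y; first by rewrite xy distxx.
by move=> d1; apply: contraT => /(dist_gt1 nxy); rewrite d1.
Qed.

Lemma adj_dist x y : G x y -> dist G x y = 1%N.
Proof.
move=> xy; have xny : x != y by apply: contraTneq xy => ->; rewrite adj_irr.
apply/eqP; rewrite eqn_leq dist_gt0 // andbT.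
by have := @dist_min _ G x ([:: y]); rewrite /= xy; apply.
Qed.

Lemma common_neighbor_dist x y z : x != y -> ~~ G x y -> G x z -> G z y -> dist G x y = 2%N.
Proof.
move=> xny nxy xz zy; apply/eqP; rewrite eqn_leq dist_gt1 // andbT.
by have := @dist_min _ G x ([:: z; y]); rewrite /= xz zy; apply.
Qed.

End Distance.

Local Open Scope ring_scope.

Section Eta.
Variables (R : realType) (V : finType) (G : sgraph V).
Implicit Types (x y z : V -> R).
Local Notation eta := (eta R G).
Local Notation d v w := ((dist G v w)%:R : R).

(** Functions on V replace vectors indexed by an enumeration of V; [lap x] is the matrix applied to
    x. *)
Definition lap x v : R := \sum_w d v w * (x v + x w).
Definition dot x y : R := \sum_v x v * y v.
Definition form x y : R := \sum_v lap x v * y v.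

Lemma formC x y : form x y = form y x.
Proof.
rewrite /form /lap; under eq_bigr => v _ do rewrite mulr_suml.
under [RHS]eq_bigr => v _ do rewrite mulr_suml.
have e (a b : V -> R) : \sum_v \sum_w d v w * (a v + a w) * b v =
    \sum_v \sum_w d v w * (a v * b v) + \sum_v \sum_w d v w * (a w * b v).
  rewrite -big_split; apply: eq_bigr => v _; rewrite -big_split /=.
  by apply: eq_bigr => w _; ring.
rewrite !e; congr (_ + _); first by apply: eq_bigr => v _; apply: eq_bigr => w _; ring.
rewrite exchange_big; apply: eq_bigr => v _; apply: eq_bigr => w _.
by rewrite distC; ring.
Qed.

Lemma formD x y t : form (fun v => x v + t * y v) (fun v => x v + t * y v) =
  form x x + 2 * t * form x y + t ^+ 2 * form y y.
Proof.
have -> : form (fun v => x v + t * y v) (fun v => x v + t * y v) =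
    form x x + t * form x y + t * form y x + t ^+ 2 * form y y.
  rewrite /form !mulr_sumr -!big_split /=; apply: eq_bigr => v _.
  have -> : lap (fun v => x v + t * y v) v = lap x v + t * lap y v.
    by rewrite /lap mulr_sumr -big_split /=; apply: eq_bigr => w _; ring.
  by ring.
by rewrite (formC y x); ring.
Qed.

Lemma dotD x y t : dot (fun v => x v + t * y v) (fun v => x v + t * y v) =
  dot x x + 2 * t * dot x y + t ^+ 2 * dot y y.
Proof.
by rewrite /dot !mulr_sumr -!big_split /=; apply: eq_bigr => v _; ring.
Qed.

Let Q := distance_signless_laplacian R G.
Let row_of x : 'rV[R]_#|V| := \row_i x (enum_val i).
Let fun_of (r : 'rV[R]_#|V|) : V -> R := fun v => r 0 (enum_rank v).

Lemma row_ofK r : row_of (fun_of r) = r.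
Proof. by apply/rowP => i; rewrite mxE /fun_of enum_valK. Qed.

Lemma sum_enum_val (F : V -> R) : \sum_(i < #|V|) F (enum_val i) = \sum_v F v.
Proof.
rewrite (reindex_onto enum_rank enum_val) /= => [|i _]; last by rewrite enum_valK.
by apply: eq_big => v; rewrite ?enum_rankK ?eqxx.
Qed.

Lemma laplacian_sym : Q^T = Q.
Proof.
by rewrite /Q linearD /= tr_diag_mx; congr (_ + _); apply/matrixP => i j; rewrite !mxE distC.
Qed.

Lemma row_of_laplacian x : row_of x *m Q = row_of (lap x).
Proof.
apply/rowP => i; rewrite /Q mulmxDr !mxE.
under eq_bigr => j _ do rewrite !mxE.
under [X in _ + X]eq_bigr => j _ do rewrite !mxE.
rewrite (bigD1 i) //= eqxx mulr1n big1 ?addr0; last first.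
  by move=> j /negPf ji; rewrite ji mulr0n mulr0.
rewrite (sum_enum_val (fun w => x w * d w (enum_val i))) /lap /transmission natr_sum.
rewrite mulr_sumr -big_split /=; apply: eq_bigr => w _.
by rewrite (distC G w); ring.
Qed.

Lemma bil_form x : bil Q (row_of x) (row_of x) = form x x.
Proof.
rewrite /bil row_of_laplacian mxE /form -sum_enum_val.
by apply: eq_bigr => i _; rewrite !mxE.
Qed.

Lemma sqn_dot x : sqn (row_of x) = dot x x.
Proof.
rewrite /sqn mxE /dot -sum_enum_val.
by apply: eq_bigr => i _; rewrite !mxE.
Qed.

Hypothesis V0 : (0 < #|V|)%N.

Lemma eta_max : eigenvalue Q eta /\ forall x, form x x <= eta * dot x x.
Proof.
have [mu emu mub] := symmetric_max_eigenvalue V0 laplacian_sym.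
have ub a : eigenvalue Q a -> a <= mu.
  case/eigenvalueP=> r rQ r0; have := mub r.
  rewrite /bil rQ -scalemxAl mxE -/(sqn r).
  by rewrite ler_pM2r // sqn_gt0.
have -> : eta = mu.
  apply/eqP; rewrite eq_le; apply/andP; split.
    by apply: sup_le_ub; [exists mu | move=> a; apply: ub].
  by apply: sup_upper_bound => //; split; [exists mu | exists mu => a; apply: ub].
by split=> // x; rewrite -bil_form -sqn_dot.
Qed.

Lemma form_le_eta x : form x x <= eta * dot x x.
Proof. by have [_] := eta_max; apply. Qed.

Lemma eta_eigenvector : exists x, (exists v, x v != 0) /\ forall v, lap x v = eta * x v.
Proof.
have [/eigenvalueP[r rQ r0] _] := eta_max.
exists (fun_of r); split.
  apply/existsP; apply: contra_neqT r0 => /existsPn z; apply/rowP => i.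
  have := z (enum_val i); rewrite /fun_of enum_valK mxE negbK => /eqP ->.
  by [].
move=> v; have := congr1 (fun s : 'rV_#|V| => s 0 (enum_rank v)) rQ.
by rewrite -{1}(row_ofK r) row_of_laplacian !mxE enum_rankK.
Qed.

Lemma perron : (1 < #|V|)%N -> connected_graph G ->
  exists2 w : V -> R, forall v, 0 < w v & forall v, lap w v = eta * w v.
Proof.
move=> V1 Gc; have [x [[v0 xv0] lx]] := eta_eigenvector.
(* |x| maximizes the Rayleigh quotient too, hence is an eigenvector. *)
pose y v := `|x v|.
have yy : dot y y = dot x x.
  by apply: eq_bigr => v _; rewrite /y -normrM ger0_norm // -expr2 sqr_ge0.
have fxy : form x x <= form y y.
  apply: ler_sum => v _; rewrite /lap !mulr_suml; apply: ler_sum => w _.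
  rewrite -!mulrA; apply: ler_wpM2l; first exact: ler0n.
  rewrite !mulrDl; apply: lerD; first by rewrite /y -normrM; apply: ler_norm.
  by rewrite /y -normrM; apply: ler_norm.
have fy : form y y = eta * dot y y.
  apply/eqP; rewrite eq_le form_le_eta /= yy; apply: le_trans fxy.
  rewrite /form /dot mulr_sumr; apply: ler_sum => v _.
  by rewrite lx mulrA.
have ly v : lap y v = eta * y v.
  (* First variation: the maximizer y is perturbed along the indicator of v. *)
  pose z w : R := (w == v)%:R.
  have dz a : \sum_w a w * z w = a v :> R.
    rewrite (bigD1 v) //= /z eqxx mulr1 big1 ?addr0 // => w /negPf ->.
    by rewrite mulr0.
  have ineq t : 0 <= 2 * t * (eta * y v - lap y v) + t ^+ 2 * (eta * dot z z - form z z).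
    have := form_le_eta (fun w => y w + t * z w).
    rewrite formD dotD fy [dot y z]dz [form y z]dz; lra.
  move: ineq; set a := _ - _; set b := _ - _ => ineq.
  have b0 : 0 <= b by rewrite subr_ge0 form_le_eta.
  have : a = 0; last by rewrite /a; lra.
  have b1 : b + 1 != 0 by rewrite gt_eqF //; lra.
  (* With this t the right side is a negative multiple of a^2; b + 1 instead of b keeps the
     denominator positive. *)
  have := ineq (- a / (b + 1)).
  have -> : 2 * (- a / (b + 1)) * a + (- a / (b + 1)) ^+ 2 * b =
    - (a ^+ 2 * (b + 2) / (b + 1) ^+ 2).
    by field.
  rewrite oppr_ge0 => h; apply/eqP; rewrite -sqrf_eq0 eq_le sqr_ge0 andbT.
  move: h; rewrite ler_pdivrMr ?mul0r; last by rewrite exprn_gt0 //; lra.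
  by rewrite pmulr_lle0 //; lra.
exists y => // v; rewrite /y normr_gt0; apply/eqP => xv.
have yv : y v = 0 by rewrite /y xv normr0.
have := ly v; rewrite yv mulr0 /lap => /eqP.
rewrite psumr_eq0 => [|w _]; last by rewrite yv add0r mulr_ge0 ?normr_ge0.
move=> /allP/(_ v0); rewrite mem_index_enum => /(_ isT).
rewrite yv add0r mulf_eq0 /y normr_eq0 (negPf xv0) orbF pnatr_eq0.
have vv0 : v != v0 by apply: contraNneq xv0 => <-; apply/eqP.
by have := dist_gt0 Gc vv0; rewrite lt0n => /negPf ->.
Qed.

End Eta.

(** * The extremal graph *)

(** Subtracting the two eigenvalue equations gives (eta - T)(w v - w v') = 0, and eta = T would make
    a positive sum vanish. *)
Lemma eigenvector_twins (R : realType) (V : finType) (G : sgraph V) (w : V -> R) eta v v' :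
    (forall v, 0 < w v) -> (forall v, lap G w v = eta * w v) ->
    connected_graph G ->
    (forall u, u != v -> u != v' -> dist G v u = dist G v' u) -> w v = w v'.
Proof.
move=> wp lw Gc tw; have [->//|vv'] := eqVneq v v'.
have v'v : v' != v by rewrite eq_sym.
pose T : R := \sum_(u | (u != v) && (u != v')) (dist G v u)%:R.
pose W : R := \sum_(u | (u != v) && (u != v')) (dist G v u)%:R * w u.
pose D : R := (dist G v v')%:R.
have ev : eta * w v = D * (w v + w v') + T * w v + W.
  rewrite -lw /lap (bigD1 v) //= distxx mul0r add0r (bigD1 v') //= -addrA.
  congr (_ + _); rewrite mulr_suml -big_split /=.
  by apply: eq_bigr => u _; ring.
have ev' : eta * w v' = D * (w v + w v') + T * w v' + W.
  rewrite -lw /lap (bigD1 v') //= distxx mul0r add0r (bigD1 v) //= -addrA.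
  rewrite distC [w v' + _]addrC; congr (_ + _); rewrite mulr_suml -big_split /=.
  apply: eq_big => [u|u /andP[u1 u2]]; first by rewrite andbC.
  by rewrite -(tw u u2 u1); ring.
have D0 : 0 < D by rewrite ltr0n dist_gt0.
have W0 : 0 <= W by apply: sumr_ge0 => u _; rewrite mulr_ge0 ?ler0n ?ltW.
have : (eta - T) * (w v - w v') = 0 by lra.
move/eqP; rewrite mulf_eq0 => /orP[|]; last by rewrite subr_eq0 => /eqP.
have := mulr_gt0 D0 (addr_gt0 (wp v) (wp v')).
move=> h /eqP eT; have eT' : eta = T by lra.
by move: ev h W0; rewrite eT'; lra.
Qed.

Section Extremal.
Variables (R : realType) (t n : nat).
Hypotheses (t0 : (0 < t)%N) (tn : (9 * t + 3 <= n)%N).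

Definition extremal := join (complete t) (disjoint_union (complete (n - 2 * t)) (edgeless t)).

(** A vertex of K_t is adjacent to all others, so no distance exceeds 2. *)
Let hub : 'I_t + ('I_(n - 2 * t) + 'I_t) := inl (Ordinal t0).

Lemma extremal_connected : connected_graph extremal.
Proof.
have ch x : connect extremal hub x.
  case: x => [i|x]; last exact: connect1.
  have [<-|ih] := eqVneq (Ordinal t0) i; first exact: connect0.
  exact: connect1.
move=> x y; apply: (connect_trans _ (ch y)).
by rewrite (sym_connect_sym (@adj_sym _ extremal)).
Qed.

Lemma extremal_dist x y :
  dist extremal x y = if x == y then 0%N else if extremal x y then 1%N else 2%N.
Proof.
case: eqVneq => [->|xy]; first exact: distxx.
case: ifP => [|/negbT] exy; first by apply: adj_dist => //; apply: extremal_connected.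
apply: (@common_neighbor_dist _ _ extremal_connected _ _ hub) => //.
  by case: x y xy exy => [i|x] [j|y] //= xy; rewrite negbK => /eqP ij; rewrite ij eqxx in xy.
by case: x y xy exy => [i|x] [j|y] //= xy; rewrite negbK => /eqP ij; rewrite ij eqxx in xy.
Qed.

Lemma sum_off_diagonal m (i : 'I_m) (K : R) :
  \sum_(j < m) (if i == j then 0 else K) = (m%:R - 1) * K.
Proof.
rewrite (bigD1 i) //= eqxx add0r.
rewrite (eq_bigr (fun=> K)) => [|j ji]; last by rewrite eq_sym (negPf ji).
rewrite sumr_const cardC1 card_ord -[K *+ _]mulr_natl.
by case: m i => [[]//|m] i; rewrite succnK -natr1 addrK.
Qed.

(** By symmetry the Perron vector is constant on each class: c on K_t, b on K_{n-2t}, a on tK_1. *)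
Lemma extremal_equations : exists a b c : R, let T := t%:R in let N := n%:R in
  let eta := eta R extremal in
  [/\ 0 < a, 0 < b, 0 < c
    & [/\ eta * c = 2 * (T - 1) * c + (N - 2 * T) * (c + b) + T * (c + a),
         eta * b = T * (b + c) + 2 * (N - 2 * T - 1) * b + 2 * T * (a + b)
       & eta * a = T * (a + c) + 2 * (N - 2 * T) * (a + b) + 4 * (T - 1) * a]].
Proof.
have m0 : (0 < n - 2 * t)%N by lia.
have V1 : (1 < #|{: 'I_t + ('I_(n - 2 * t) + 'I_t)}|)%N.
  by rewrite !card_sum !card_ord; lia.
have [w wp lw] := @perron R _ extremal (ltnW V1) V1 extremal_connected.
have tw v v' : (forall u, u != v -> u != v' -> extremal v u = extremal v' u) -> w v = w v'.
  move=> e; apply: (eigenvector_twins wp lw extremal_connected) => u uv uv'.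
  by rewrite !extremal_dist ![_ == u]eq_sym (negPf uv) (negPf uv') e.
pose c := w (inl (Ordinal t0)); pose b := w (inr (inl (Ordinal m0))).
pose a := w (inr (inr (Ordinal t0))).
have wc i : w (inl i) = c.
  apply: tw => -[j|[j|j]] //= ji ji'.
  by rewrite [i == j]eq_sym [_ == j]eq_sym (ji : j != i) (ji' : j != _).
have wb i : w (inr (inl i)) = b.
  apply: tw => -[j|[j|j]] //= ji ji'.
  by rewrite [i == j]eq_sym [_ == j]eq_sym (ji : j != i) (ji' : j != _).
have wa i : w (inr (inr i)) = a by apply: tw => -[j|[j|j]].
exists a, b, c => /=; split; [exact: wp|exact: wp|exact: wp|].
have NT : (n - 2 * t)%:R = n%:R - 2 * t%:R :> R by rewrite natrB ?natrM //; lia.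
have lapE v : eta R extremal * w v =
    \sum_i (dist extremal v (inl i))%:R * (w v + c)
    + (\sum_i (dist extremal v (inr (inl i)))%:R * (w v + b)
       + \sum_i (dist extremal v (inr (inr i)))%:R * (w v + a)).
  rewrite -lw /lap !big_sumType /=; congr (_ + (_ + _)); apply: eq_bigr => i _.
  - by rewrite wc.
  - by rewrite wb.
  - by rewrite wa.
have sumc m (K : R) : \sum_(i < m) K = m%:R * K.
  by rewrite sumr_const card_ord mulr_natl.
have off m (i : 'I_m) (F : bool -> R) : F true = 0 ->
    \sum_j F (i == j) = (m%:R - 1) * F false.
  move=> F0; rewrite -(sum_off_diagonal i); apply: eq_bigr => j _.
  by case: eqP.
split.
- rewrite lapE -/c; under eq_bigr => i _ do rewrite extremal_dist /=.
  under [X in _ + (X + _)]eq_bigr => i _ do rewrite extremal_dist /= mul1r.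
  under [X in _ + (_ + X)]eq_bigr => i _ do rewrite extremal_dist /= mul1r.
  rewrite (off _ (Ordinal t0) (fun e =>
    (if e then 0%N else if ~~ e then 1%N else 2%N)%:R * (c + c))) ?mul0r //.
  by rewrite !sumc NT /=; ring.
- rewrite lapE -/b; under eq_bigr => i _ do rewrite extremal_dist /= mul1r.
  under [X in _ + (X + _)]eq_bigr => i _ do rewrite extremal_dist /=.
  under [X in _ + (_ + X)]eq_bigr => i _ do rewrite extremal_dist /=.
  rewrite (off _ (Ordinal m0) (fun e =>
    (if e then 0%N else if ~~ e then 1%N else 2%N)%:R * (b + b))) ?mul0r //.
  by rewrite !sumc NT /=; ring.
- rewrite lapE -/a; under eq_bigr => i _ do rewrite extremal_dist /= mul1r.
  under [X in _ + (X + _)]eq_bigr => i _ do rewrite extremal_dist /=.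
  under [X in _ + (_ + X)]eq_bigr => i _ do rewrite extremal_dist /=.
  rewrite (off _ (Ordinal t0) (fun e => (if e then 0%N else 2%N)%:R * (a + a))) ?mul0r //.
  by rewrite !sumc NT /=; ring.
Qed.

End Extremal.

(** * Bounds on the extremal eigenvalue and its Perron vector *)

Section Estimates.
Variables (R : realType) (T N eta a b c : R).
Hypotheses (T1 : 1 <= T) (TN : 9 * T + 3 <= N).
Hypotheses (a0 : 0 < a) (b0 : 0 < b) (c0 : 0 < c).
Hypothesis eqc : eta * c = 2 * (T - 1) * c + (N - 2 * T) * (c + b) + T * (c + a).
Hypothesis eqb : eta * b = T * (b + c) + 2 * (N - 2 * T - 1) * b + 2 * T * (a + b).
Hypothesis eqa : eta * a = T * (a + c) + 2 * (N - 2 * T) * (a + b) + 4 * (T - 1) * a.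

(* Collatz-Wielandt with the weights 3, 1, 4/5 on the three vertex classes *)
Lemma eta_upper : eta <= 8 / 3 * N - 4.
Proof.
have e : eta * (3 * T * a + (N - 2 * T) * b + 4 / 5 * T * c) =
    T * a * (8 * N - 1 / 5 * T - 12) + (N - 2 * T) * b * (2 * N + 29 / 5 * T - 2)
    + T * c * (9 / 5 * N + 9 / 5 * T - 8 / 5).
  have -> : eta * (3 * T * a + (N - 2 * T) * b + 4 / 5 * T * c) =
    3 * T * (eta * a) + (N - 2 * T) * (eta * b) + 4 / 5 * T * (eta * c) by ring.
  by rewrite eqa eqb eqc; field.
have W0 : 0 < 3 * T * a + (N - 2 * T) * b + 4 / 5 * T * c.
  have : 0 < T * a by apply: mulr_gt0 => //; move: T1 TN; lra.
  have : 0 < (N - 2 * T) * b by apply: mulr_gt0 => //; move: T1 TN; lra.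
  have : 0 < T * c by apply: mulr_gt0 => //; move: T1 TN; lra.
  by lra.
rewrite -(ler_pM2r W0) e.
(* The class tK_1 dictates the bound, as its row ratio is (8N - T/5 - 12)/3. *)
have h1 : 0 <= T * a * (3 * (8 / 3 * N - 4) - (8 * N - 1 / 5 * T - 12)).
  by apply: mulr_ge0; [apply: mulr_ge0|]; move: T1 TN a0 b0 c0; lra.
(* This needs N >= 8.7 T + 3, the closest use of N >= 9 T + 3. *)
have h2 : 0 <= (N - 2 * T) * b * (8 / 3 * N - 4 - (2 * N + 29 / 5 * T - 2)).
  by apply: mulr_ge0; [apply: mulr_ge0|]; move: T1 TN a0 b0 c0; lra.
have h3 : 0 <= T * c * (4 / 5 * (8 / 3 * N - 4) - (9 / 5 * N + 9 / 5 * T - 8 / 5)).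
  by apply: mulr_ge0; [apply: mulr_ge0|]; move: T1 TN a0 b0 c0; lra.
rewrite -subr_ge0; apply: le_trans (addr_ge0 (addr_ge0 h1 h2) h3) _.
by rewrite le_eqVlt; apply/orP; left; apply/eqP; field.
Qed.

(** Bounds the loss when the Perron vector is transplanted. The equation for b gives 2Ta <= pb;
    subtracting it from the one for a gives (p + 2)a = rb. Hence Ta^2 <= rb^2/2 and 2Tab <= pb^2,
    and [eta_upper] bounds r/2 + p + T. *)
Lemma weight_ratio : T * (a + b) ^+ 2 <= (2 * N + T / 2 - 3) * b ^+ 2.
Proof.
pose p := eta - 2 * N + T + 2; pose r := eta - 3 * T + 2.
have Tc : 0 < T * c by apply: mulr_gt0 => //; move: T1 TN; lra.
have Ta : 0 < T * a by apply: mulr_gt0 => //; move: T1 TN; lra.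
have e1 : 2 * T * a <= p * b by rewrite /p; move: eqb Tc; lra.
have e2 : (p + 2) * a = r * b by rewrite /p /r; move: eqa eqb; lra.
have p0 : 0 < p by rewrite -(pmulr_lgt0 _ b0); lra.
have r0 : 0 < r.
  by rewrite -(pmulr_lgt0 _ b0) -e2; apply: mulr_gt0 => //; lra.
have e3 : 2 * (T * a ^+ 2) <= r * b ^+ 2.
  have p2 : 0 < p + 2 by lra.
  rewrite -(ler_pM2r p2).
  have -> : 2 * (T * a ^+ 2) * (p + 2) = (2 * T * a) * ((p + 2) * a) by ring.
  rewrite e2; have rb : 0 < r * b by apply: mulr_gt0.
  have := ler_wpM2r (ltW rb) e1; move/le_trans; apply.
  have : 0 < r * b ^+ 2 by rewrite mulr_gt0 // exprn_gt0.
  have -> : p * b * (r * b) = p * (r * b ^+ 2) by ring.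
  by move: (r * b ^+ 2) => q q0; lra.
have up := eta_upper.
have b2 : 0 < b ^+ 2 by rewrite exprn_gt0.
have e4 : 2 * T * a * b <= p * b ^+ 2 by rewrite expr2 mulrA ler_pM2r.
have : (r / 2 + p + T) * b ^+ 2 <= (2 * N + T / 2 - 3) * b ^+ 2.
  by rewrite ler_pM2r // /r /p; move: TN up; lra.
by apply: le_trans; rewrite sqrrD; lra.
Qed.

End Estimates.


Lemma ex_subset_card (V : finType) (A : {set V}) k :
  (k <= #|A|)%N -> exists2 B : {set V}, B \subset A & #|B| = k.
Proof.
move=> kA; exists [set x in take k (enum A)].
  by apply/subsetP => x; rewrite inE => /mem_take; rewrite mem_enum.
rewrite cardsE (card_uniqP _) ?take_uniq ?enum_uniq // size_take -cardE.
by case: ltngtP kA.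
Qed.

Lemma sum_classes (R : pzRingType) (V : finType) (kap : V -> nat) k (f : nat -> R) :
    (forall v, (kap v < k)%N) ->
  \sum_v f (kap v) = \sum_(i < k) #|[set v | kap v == i]|%:R * f i.
Proof.
move=> kapk; pose h v := Ordinal (kapk v).
rewrite (partition_big h predT) //=; apply: eq_bigr => i _.
rewrite (eq_bigr (fun=> f i)) => [|v /eqP <-//].
rewrite sumr_const mulr_natl; congr (_ *+ _).
by apply: eq_card => v; rewrite [RHS]inE.
Qed.

(** * Test vectors for a graph with many isolated vertices outside S *)

Section TestVector.
Variables (R : realType) (V : finType) (G : sgraph V).
Hypothesis Gc : connected_graph G.
Variables (I S I1 S1 : {set V}).
Hypothesis NI : forall v w, v \in I -> G v w -> w \in S.
Hypothesis SI : [disjoint S & I].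
Hypotheses (I1I : I1 \subset I) (S1S : S1 \subset S).

(* These pairs are at distance at least 2 whatever the rest of G is. *)
Let far v w := (v \in I) && (w \notin S) || (w \in I) && (v \notin S).

(** Numbering: 0 is I1, 1 the rest of I, 2 is S1, 3 the rest of S, 4 everything else. *)
Definition class v : nat :=
  if v \in I then nat_of_bool (v \notin I1) else if v \in S then (2 + (v \notin S1))%N else 4.

(** Distances between distinct vertices in the densest case: the join of a complete graph on S with
    isolated vertices I and a complete graph on the rest. *)
Let D (k l : nat) : R :=
  1 + ((k < 2)%N && ((l < 2)%N || (l == 4)) || (l < 2)%N && ((k < 2)%N || (k == 4)))%:R.

Lemma class_D v w : D (class v) (class w) = 1 + (far v w)%:R.
Proof.
have dis u : ~~ ((u \in I) && (u \in S)).
  by apply/negP => /andP[uI /(disjointFr SI)]; rewrite uI.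
move: (dis v) (dis w); rewrite /D /far /class.
by case: (v \in I); case: (w \in I); case: (v \in S); case: (w \in S);
  case: (v \in I1); case: (w \in I1); case: (v \in S1); case: (w \in S1).
Qed.

Lemma dist_far v w : v != w -> 1 + (far v w)%:R <= (dist G v w)%:R :> R.
Proof.
move=> vw; have nG a b : a \in I -> b \notin S -> ~~ G a b.
  by move=> aI; apply: contra; apply: NI.
rewrite -[1]/(1%:R) -natrD ler_nat; case fvw: (far v w); last exact: dist_gt0.
apply: dist_gt1 => //; case/orP: fvw => /andP[]; first exact: nG.
by rewrite adj_sym; apply: nG.
Qed.

Variable X : nat -> R.
Hypothesis X0 : forall k, 0 < X k.

Let nk k : R := #|[set v | class v == k]|%:R.

Definition test v := X (class v).

(** The quadratic form of that densest graph at the test vector; the subtracted term removes the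
    pairs (v, v) counted by the sum over classes. *)
Definition class_form : R :=
  \sum_(k < 5) nk k * ((\sum_(l < 5) nk l * (D k l * (X k + X l)) - 2 * D k k * X k) * X k).

Lemma class_lt v : (class v < 5)%N.
Proof.
by rewrite /class; case: (v \in I); case: (v \in S); case: (v \in I1); case: (v \in S1).
Qed.

Lemma class_formE : class_form =
  \sum_v \sum_w (if v == w then 0 else 1 + (far v w)%:R) * (test v + test w) * test v.
Proof.
rewrite /class_form -(sum_classes (fun k => ((\sum_(l < 5) nk l * (D k l * (X k + X l))
   - 2 * D k k * X k) * X k)) class_lt).
apply: eq_bigr => v _; rewrite -mulr_suml; congr (_ * _).
rewrite -(sum_classes (fun l => D (class v) l * (X (class v) + X l)) class_lt).
rewrite (bigD1 v) //= [RHS](bigD1 v) //= eqxx mul0r add0r.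
have -> : D (class v) (class v) * (X (class v) + X (class v)) =
  2 * D (class v) (class v) * X (class v) by ring.
rewrite addrAC subrr add0r; apply: eq_bigr => w wv.
by rewrite eq_sym (negPf wv) class_D.
Qed.

Let gap v w : R :=
  ((dist G v w)%:R - (if v == w then 0 else 1 + (far v w)%:R)) * (test v + test w) * test v.

Lemma gap_ge0 v w : 0 <= gap v w.
Proof.
have tp u : 0 <= test u by apply/ltW/X0.
rewrite /gap; case: eqVneq => [->|vw]; first by rewrite distxx subrr !mul0r.
by rewrite !mulr_ge0 ?subr_ge0 ?addr_ge0 // dist_far.
Qed.

Lemma form_gap : form G test test = class_form + \sum_v \sum_w gap v w.
Proof.
rewrite class_formE -big_split; apply: eq_bigr => v _.
rewrite /lap mulr_suml -big_split; apply: eq_bigr => w _.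
by rewrite /= /gap !mulrBl addrC subrK.
Qed.

Lemma class_form_le : class_form <= form G test test.
Proof.
by rewrite form_gap lerDl; apply: sumr_ge0 => v _; apply: sumr_ge0 => w _; apply: gap_ge0.
Qed.

(** Equality leaves no gap at any pair, and all weights are positive, so pairs that are not far have
    distance exactly 1. *)
Lemma adj_of_form_le v w : form G test test <= class_form -> v != w -> ~~ far v w -> G v w.
Proof.
rewrite form_gap gerDl => le0 vw nf.
have s0 u : 0 <= \sum_w gap u w by apply: sumr_ge0 => z _; apply: gap_ge0.
have : \sum_v \sum_w gap v w == 0.
  by rewrite eq_le le0 sumr_ge0.
rewrite psumr_eq0 // => /allP/(_ v); rewrite mem_index_enum => /(_ isT) /=.
rewrite psumr_eq0 => [|z _]; last exact: gap_ge0.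
move=> /allP/(_ w); rewrite mem_index_enum => /(_ isT) /=.
rewrite /gap (negPf vw) (negPf nf) addr0 !mulf_eq0.
have /gt_eqF -> : 0 < test v by apply: X0.
have /gt_eqF -> : 0 < test v + test w by apply: addr_gt0; apply: X0.
rewrite !orbF subr_eq0 => /eqP d1; apply: dist1_adj => //.
by apply/eqP; rewrite -(eqr_nat R) d1.
Qed.

Lemma dot_test : dot test test = \sum_(k < 5) nk k * (X k * X k).
Proof. by rewrite /dot -(sum_classes (fun k => X k * X k) class_lt). Qed.

Variables (t s n : nat).
Hypotheses (cI : #|I| = s) (cS : #|S| = s) (cI1 : #|I1| = t) (cS1 : #|S1| = t) (cV : #|V| = n).

Lemma class_card : [/\ nk 0 = t%:R, nk 1 = s%:R - t%:R, nk 2 = t%:R, nk 3 = s%:R - t%:R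
  & nk 4 = n%:R - 2 * s%:R].
Proof.
have dis u : ~~ ((u \in I) && (u \in S)).
  by apply/negP => /andP[uI /(disjointFr SI)]; rewrite uI.
have i1 u : (u \in I1) ==> (u \in I) by apply/implyP/(subsetP I1I).
have s1 u : (u \in S1) ==> (u \in S) by apply/implyP/(subsetP S1S).
have ts : (t <= s)%N by rewrite -cI1 -cI subset_leq_card.
have bash (A : {set V}) k :
    (forall u, (class u == k) = (u \in A)) -> nk k = #|A|%:R.
  by move=> e; congr (_%:R); apply: eq_card => u; rewrite inE.
have c2 : #|S :|: I| = (2 * s)%N.
  by rewrite cardsU (disjoint_setI0 SI) cards0 cS cI; lia.
split; [rewrite -cI1 | rewrite -natrB // -{1}cI -cI1 -{1}(setIidPr I1I) -cardsD
  | rewrite -cS1 | rewrite -natrB // -{1}cS -cS1 -{1}(setIidPr S1S) -cardsD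
  | have := cardsC (S :|: I); rewrite c2 cV => <-; rewrite natrD natrM addrAC subrr add0r];
  apply: bash => u; move: (dis u) (i1 u) (s1 u); rewrite /class ?inE;
  by case: (u \in I); case: (u \in S); case: (u \in I1); case: (u \in S1).
Qed.

Lemma class_form_poly : let T := t%:R in let S := s%:R in let N := n%:R in
  class_form =
    T * X 0 * (4 * T * X 0 + 2 * (S - T) * (X 0 + X 1) + T * (X 0 + X 2)
               + (S - T) * (X 0 + X 3) + 2 * (N - 2 * S) * (X 0 + X 4) - 4 * X 0)
  + (S - T) * X 1 * (2 * T * (X 1 + X 0) + 4 * (S - T) * X 1 + T * (X 1 + X 2)
               + (S - T) * (X 1 + X 3) + 2 * (N - 2 * S) * (X 1 + X 4) - 4 * X 1)
  + T * X 2 * (T * (X 2 + X 0) + (S - T) * (X 2 + X 1) + 2 * T * X 2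
               + (S - T) * (X 2 + X 3) + (N - 2 * S) * (X 2 + X 4) - 2 * X 2)
  + (S - T) * X 3 * (T * (X 3 + X 0) + (S - T) * (X 3 + X 1) + T * (X 3 + X 2)
               + 2 * (S - T) * X 3 + (N - 2 * S) * (X 3 + X 4) - 2 * X 3)
  + (N - 2 * S) * X 4 * (2 * T * (X 4 + X 0) + 2 * (S - T) * (X 4 + X 1)
               + T * (X 4 + X 2) + (S - T) * (X 4 + X 3) + 2 * (N - 2 * S) * X 4 - 2 * X 4).
Proof.
have [n0 n1 n2 n3 n4] := class_card.
rewrite /= /class_form !big_ord_recr !big_ord0 /= n0 n1 n2 n3 n4 /D /=.
by ring.
Qed.

Lemma dot_test_poly : let T := t%:R in let S := s%:R in let N := n%:R in
  dot test test = T * X 0 ^+ 2 + (S - T) * X 1 ^+ 2 + T * X 2 ^+ 2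
                  + (S - T) * X 3 ^+ 2 + (N - 2 * S) * X 4 ^+ 2.
Proof.
have [n0 n1 n2 n3 n4] := class_card.
rewrite /= dot_test !big_ord_recr !big_ord0 /= n0 n1 n2 n3 n4.
by ring.
Qed.

End TestVector.

(** For weight 3 on z isolated vertices and 1 elsewhere, the first two terms on the right are the
    form of K_N, (N - 2)|x|^2 plus the squared sum of x; the others add 6^2 per pair inside I and
    4^2 per pair between I and the rest. *)
Lemma half_independent_estimate (R : realType) (T N z : R) :
    1 <= T -> T <= z -> 2 * z <= N -> N <= 8 * z ->
  (8 / 3 * N - 4) * (N + 8 * z) < (N - 2) * (N + 8 * z) + (N + 2 * z) ^+ 2
    + 18 * z * (z - 1) + 16 * z * (N - 2 * z).
Proof.
move=> T1 Tz zN Nz.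
have p1 : 0 <= (8 * z - N) * (N - 2 * z) by apply: mulr_ge0; lra.
have p2 : 0 <= N * (8 * z - N) by apply: mulr_ge0; lra.
have p3 : 0 <= N * z by apply: mulr_ge0; lra.
lra.
Qed.

Section Sparse.
Variables (R : realType) (t n s : nat) (V : finType) (G : sgraph V).
Hypotheses (t0 : (0 < t)%N) (tn : (9 * t + 3 <= n)%N) (cV : #|V| = n).
Hypothesis Gc : connected_graph G.
Hypothesis G_eta : eta R G <= eta R (extremal t n).

Lemma sparse_extremal (I S : {set V}) :
    (forall v w, v \in I -> G v w -> w \in S) -> [disjoint S & I] ->
    #|I| = s -> #|S| = s -> (t <= s)%N ->
  s = t /\ forall v w, v != w ->
    ~~ ((v \in I) && (w \notin S) || (w \in I) && (v \notin S)) -> G v w.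
Proof.
move=> NI SI cI cS ts.
have [I1 I1I cI1] : exists2 B : {set V}, B \subset I & #|B| = t.
  by apply: ex_subset_card; rewrite cI.
have [S1 S1S cS1] : exists2 B : {set V}, B \subset S & #|B| = t.
  by apply: ex_subset_card; rewrite cS.
have sn : (2 * s <= n)%N.
  have := max_card (mem (S :|: I)); rewrite cardsU (disjoint_setI0 SI) cards0 cS cI cV.
  by lia.
have V0 : (0 < #|V|)%N by lia.
have [a [b [c /=]]] := extremal_equations R t0 tn.
have le_eta := G_eta; set eta := Defs.eta R (extremal t n) in le_eta *.
pose T : R := t%:R; pose N : R := n%:R.
rewrite -/T -/N; case=> a0 b0 c0 [eqc eqb eqa].
have T1 : 1 <= T by rewrite ler1n.
have TN : 9 * T + 3 <= N by rewrite -natrM -natrD ler_nat.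
have up := eta_upper T1 TN a0 b0 c0 eqc eqb eqa.
have wr := weight_ratio T1 TN a0 b0 c0 eqc eqb eqa.
have TS : T <= s%:R by rewrite ler_nat.
have SN : 2 * s%:R <= N by rewrite -natrM ler_nat.
have key X : (forall k, 0 < X k) ->
    form G (test I S I1 S1 X) (test I S I1 S1 X) <= eta * dot (test I S I1 S1 X) (test I S I1 S1 X).
  move=> X0; apply: le_trans (form_le_eta G V0 _) _; apply: ler_wpM2r => //.
  by apply: sumr_ge0 => v _; rewrite -expr2 sqr_ge0.
have [h8|h8] := leP N (8 * s%:R).
  (* s >= n/8: weight 3 on I and 1 elsewhere already exceeds 8n/3 - 4. *)
  pose X (k : nat) : R := if (k < 2)%N then 3 else 1.
  have X0 k : 0 < X k by rewrite /X; case: ifP => _; lra.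
  have := le_trans (class_form_le Gc I1 S1 NI SI X0) (key X X0).
  rewrite (class_form_poly SI I1I S1S X cI cS cI1 cS1 cV).
  rewrite (dot_test_poly SI I1I S1S X cI cS cI1 cS1 cV).
  rewrite /X /= -/T -/N; move: up TS SN h8 T1; move: (s%:R : R) => z up TS SN h8 T1.
  rewrite [X in X <= _](_ : _ = (N - 2) * (N + 8 * z) + (N + 2 * z) ^+ 2
    + 18 * z * (z - 1) + 16 * z * (N - 2 * z)); last by ring.
  rewrite [X in _ <= _ * X](_ : _ = N + 8 * z); last by ring.
  have d0 : 0 < N + 8 * z by lra.
  rewrite -(ler_pM2r d0) in up => /le_trans/(_ up).
  by rewrite leNgt (half_independent_estimate T1 TS SN h8).
(* s < n/8: transplant the Perron vector of the extremal graph. *)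
pose X (k : nat) : R := if k is 0%N then a else if k is 2%N then c else b.
have X0 k : 0 < X k by case: k => [|[|[|k]]].
(* Compared with the extremal graph on the same weights, pairs inside I - I1 and between I - I1 and
   class 4 grow from distance 1 to 2, and pairs between I1 and S - S1 shrink from 2 to 1. *)
have fE : class_form I S I1 S1 X = eta * dot (test I S I1 S1 X) (test I S I1 S1 X)
    + (s%:R - T) * ((4 * N - 6 * s%:R - 2 * T - 2) * b ^+ 2 - T * (a + b) ^+ 2).
  rewrite (class_form_poly SI I1I S1S X cI cS cI1 cS1 cV).
  rewrite (dot_test_poly SI I1I S1S X cI cS cI1 cS1 cV).
  rewrite /X /= -/T -/N; move: (s%:R : R) => z.
  have -> : eta * (T * a ^+ 2 + (z - T) * b ^+ 2 + T * c ^+ 2 + (z - T) * b ^+ 2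
                   + (N - 2 * z) * b ^+ 2)
    = T * a * (eta * a) + T * c * (eta * c) + (N - 2 * T) * b * (eta * b) by ring.
  by rewrite eqa eqb eqc; ring.
have le1 := le_trans (class_form_le Gc I1 S1 NI SI X0) (key X X0).
have b2 : 0 < b ^+ 2 by rewrite exprn_gt0.
(* From s < N/8 follows 4N - 6s > 13N/4, well above the 2N of [weight_ratio]. *)
have pos : 0 < (4 * N - 6 * s%:R - 2 * T - 2) * b ^+ 2 - T * (a + b) ^+ 2.
  rewrite subr_gt0; apply: le_lt_trans wr _; rewrite ltr_pM2r //.
  by move: h8 TS TN; lra.
have st : s = t.
  apply/eqP; rewrite eqn_leq ts andbT -(ler_nat R) -/T -subr_le0.
  by rewrite -(pmulr_lle0 _ pos); move: le1; rewrite fE; lra.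
split=> // v w vw nf; apply: (adj_of_form_le Gc NI SI X0 _ vw nf).
by apply: le_trans (key X X0) _; rewrite fE st subrr mul0r addr0.
Qed.

End Sparse.

Local Close Scope ring_scope.

(** * The extremal graph has a Hamiltonian path *)

Section Alternating.
Variables (V : finType) (G : sgraph V).

Fixpoint alternate (us ss : seq V) : seq V :=
  if us is u :: us' then if ss is s :: ss' then u :: s :: alternate us' ss' else [::]
  else [::].

Lemma alternate_path us ss cs x :
    size us = size ss -> {in us & x :: ss, forall u s, G s u} ->
    {in x :: ss & cs, forall s c, G s c} ->
    uniq cs -> {in cs &, forall c c', c != c' -> G c c'} ->
  path G x (alternate us ss ++ cs).
Proof.
move=> szus GU GC ucs Gcs; elim: us ss x szus GU GC => [|u us IH] [|s ss] //= x.
  move=> _ _ GC; have {GC} : {in cs, forall c, G x c}.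
    by move=> c cc; apply: GC; rewrite ?mem_head.
  elim: cs x ucs Gcs => //= c cs IHc x /andP[ccs ucs] Gcs Gx.
  rewrite Gx ?mem_head //=; apply: IHc => // [c1 c2 h1 h2|c' c'cs].
    by apply: Gcs; rewrite inE ?h1 ?h2 orbT.
  by apply: Gcs; rewrite ?mem_head ?inE ?c'cs ?orbT //; apply: contraNneq ccs => ->.
move=> [szus] GU GC; rewrite GU ?mem_head //= adj_sym GU ?mem_head ?inE ?eqxx ?orbT //=.
apply: IH => // [u' s' u'us s'ss|s' c s'ss cc].
  by apply: GU; rewrite inE ?u'us ?orbT //; move: s'ss; rewrite inE => ->; rewrite orbT.
by apply: GC => //; rewrite inE s'ss orbT.
Qed.

Lemma mem_alternate us ss x : size us = size ss ->
  (x \in alternate us ss) = (x \in us) || (x \in ss).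
Proof.
elim: us ss => [|u us IH] [|s ss] //= [/IH e].
by rewrite !inE e; do !case: (_ == _); rewrite ?orbT.
Qed.

Lemma size_alternate us ss : size us = size ss ->
  size (alternate us ss) = size us + size ss.
Proof. by elim: us ss => [|u us IH] [|s ss] //= [/IH ->]; rewrite addnS. Qed.

(** The path alternates between I and S, ends this phase in S, and then runs through the clique on
    the remaining vertices in any order. *)
Lemma alternating_tree (I S : {set V}) : 4 < #|V| -> 0 < #|I| -> #|I| = #|S| ->
    [disjoint S & I] ->
    (forall v w, v != w ->
       ~~ ((v \in I) && (w \notin S) || (w \in I) && (v \notin S)) -> G v w) ->
  exists T : sgraph V, spanning_tree G T /\ 4 <= leaf_distance T.
Proof.
move=> V5 I0 cIS dis adjG.
have disV u : u \in S -> u \in I -> False.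
  by move=> uS; rewrite (disjointFr dis uS).
pose cs := enum (~: (S :|: I)).
pose P := alternate (enum I) (enum S) ++ cs.
have szIS : size (enum I) = size (enum S) by rewrite -!cardE.
have memP x : x \in P.
  by rewrite mem_cat mem_alternate // !mem_enum !inE; case: (x \in I); case: (x \in S).
have szP : size P = #|V|.
  rewrite size_cat size_alternate // -!cardE -(cardsC (S :|: I)) cardsU.
  by rewrite (disjoint_setI0 dis) cards0 subn0 [#|S| + _]addnC.
have uP : uniq P.
  apply: (@leq_size_uniq _ (enum V)); first exact: enum_uniq.
    by move=> x _; apply: memP.
  by rewrite szP -cardE.
case EI: (enum I) => [|u us]; first by rewrite cardE EI in I0.
case ES: (enum S) => [|s ss]; first by rewrite cIS cardE ES in I0.
have memI x : x \in u :: us -> x \in I by rewrite -EI mem_enum.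
have memS x : x \in s :: ss -> x \in S by rewrite -ES mem_enum.
have memC x : x \in cs -> x \notin S /\ x \notin I.
  by rewrite mem_enum !inE negb_or => /andP[].
rewrite /P EI ES /= in memP uP.
have GIS a b : a \in I -> b \in S -> G b a.
  move=> aI bS; apply: adjG.
    by apply/eqP => ba; apply: (disV b) => //; rewrite ba.
  by rewrite aI bS /= orbF; apply/negP => /andP[bI _]; apply: disV bS bI.
have GSC a b : a \in S -> b \notin S -> b \notin I -> G a b.
  move=> aS bS bI; apply: adjG; first by apply: contraNneq bS => <-.
  rewrite (negPf bI) /= orbF; apply/negP => /andP[aI _]; exact: disV aS aI.
apply: (hamiltonian_path_tree (x := u) _ uP memP V5).
rewrite /= adj_sym GIS ?memI ?memS ?mem_head //=.
apply: alternate_path; first by move: szIS; rewrite EI ES => -[].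
- by move=> a b aus bss; apply: GIS; [apply: memI; rewrite inE aus orbT | apply: memS].
- by move=> a c /memS aS /memC[cS cI]; apply: GSC.
- exact: enum_uniq.
move=> c c' /memC[cS cI] /memC[c'S c'I] cc'; apply: adjG => //.
by rewrite (negPf cI) (negPf c'I).
Qed.

End Alternating.

(** * Degrees, transmissions and the conclusion *)

Lemma min_degree_le (V : finType) (G : sgraph V) x : min_degree G <= degree G x.
Proof.
rewrite /min_degree; have : x \in index_enum V by apply: mem_index_enum.
elim: (index_enum V) => //= y r IH; rewrite inE big_cons => /orP[/eqP <-|/IH h].
  exact: geq_minl.
exact: leq_trans (geq_minr _ _) h.
Qed.

(** A neighbor contributes 1 to both transmission and degree, a farther vertex at least 2 to the
    transmission; the final 2 pays for x. *)
Lemma transmission_degree (V : finType) (G : sgraph V) x : connected_graph G ->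
  2 * #|V| <= transmission G x + degree G x + 2.
Proof.
move=> Gc.
have -> : degree G x = \sum_y G x y.
  by rewrite /degree -sum1_card big_mkcond /=; apply: eq_bigr => y _; rewrite inE; case: (G x y).
have two : \sum_y (if y == x then 2 else 0) = 2 by rewrite -big_mkcond big_pred1_eq.
rewrite -[X in _ <= _ + X]two /transmission -!big_split /= -sum1_card.
rewrite big_distrr /=; apply: leq_sum => y _; rewrite muln1.
case: eqVneq => [_|yx]; first by rewrite leq_addl.
case xy: (G x y); first by rewrite addn0 addn1 ltnS dist_gt0 // eq_sym.
by rewrite !addn0; apply: dist_gt1; rewrite ?xy // eq_sym.
Qed.

(** Otherwise all transmissions are at least 3n/2 - 2, and the all-ones vector has Rayleigh quotient
    at least 3n - 4 > 8n/3 - 4. *)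
Lemma exists_big_degree (R : realType) (V : finType) (G : sgraph V) :
    0 < #|V| -> connected_graph G ->
    (eta R G <= 8 / 3 * #|V|%:R - 4)%R ->
  exists u, #|V| < (degree G u).*2.
Proof.
move=> V0 Gc up; apply/existsP; apply: contraT => /existsPn small.
have := form_le_eta G V0 (fun=> 1 : R)%R.
have -> : (@dot R V (fun=> 1) (fun=> 1) = #|V|%:R :> R)%R.
  by rewrite /dot; under eq_bigr do rewrite mulr1; rewrite sumr_const.
have -> : (@form R V G (fun=> 1) (fun=> 1) = (\sum_v 2 * transmission G v)%N%:R :> R)%R.
  rewrite /form natr_sum; apply: eq_bigr => v _; rewrite mulr1 /lap natrM natr_sum mulr_sumr.
  by apply: eq_bigr => w _; rewrite mulrC -natr1.
have V0' : (0 < #|V|%:R :> R)%R by rewrite ltr0n.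
have : (3 * #|V| - 4) * #|V| <= \sum_v 2 * transmission G v.
  rewrite mulnC -sum_nat_const; apply: leq_sum => v _.
  by have := transmission_degree v Gc; have := small v; lia.
rewrite -(ler_nat R) => h1 h2; have := le_trans h1 h2.
rewrite natrM => h3; exfalso; move: (le_trans h3 (ler_wpM2r (ltW V0') up)).
rewrite ler_pM2r // => h4.
have : (3 * #|V|%:R <= (3 * #|V| - 4)%:R + 4 :> R)%R.
  by rewrite -natrM -natrD ler_nat; lia.
lra.
Qed.

Theorem theorem1p5 (R : realType) (t n : nat) (V : finType) (G : sgraph V)
    (t_gt0 : (0 < t)%N)
    (G_order : #|V| = n)
    (n_ge : (9 * t + 3 <= n)%N)
    (G_connected : connected_graph G)
    (G_min_degree : (t <= min_degree G)%N)
    (G_eta : (eta R G <=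
              eta R (join (complete t)
                       (disjoint_union (complete (n - 2 * t)) (edgeless t))))%R) :
  exists T : sgraph V, spanning_tree G T /\ (4 <= leaf_distance T)%N.
Proof.
have V5 : 4 < #|V| by lia.
have [expand|] := boolP [forall Y : {set V}, (Y != set0) ==>
    [forall v in Y, forall w in Y, ~~ G v w] ==> (#|Y| < #|neighbors G Y|)].
  have [a [b [c /= [a0 b0 c0 [eqc eqb eqa]]]]] := extremal_equations R t_gt0 n_ge.
  have [u degu] : exists u, #|V| < (degree G u).*2.
    apply: (@exists_big_degree R); [by lia | by [] | apply: le_trans G_eta _].
    rewrite G_order; apply: (@eta_upper _ t%:R n%:R _ a b c) => //.
      by rewrite ler1n.
    by rewrite -natrM -natrD ler_nat.
  apply: (expanding_graph_tree G_connected _ V5 degu); last by lia.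
  move=> Y Y0 iY; move: expand => /forallP/(_ Y); rewrite Y0 implyTb => /implyP; apply.
  by apply/forall_inP => v vY; apply/forall_inP => w; apply: iY.
rewrite negb_forall => /existsP[Y]; rewrite !negb_imply -leqNgt => /and3P[Y0 /forall_inP iY leY].
pose S := neighbors G Y.
(* Y is trimmed to the size of its neighborhood S; the neighbors of I still lie in S. *)
have [I IY cI] : exists2 I : {set V}, I \subset Y & #|I| = #|S| by apply: ex_subset_card.
have NI v w : v \in I -> G v w -> w \in S.
  by move=> vI vw; apply/neighborsP; exists v; rewrite // (subsetP IY).
have SI : [disjoint S & I].
  rewrite disjoint_subset; apply/subsetP => w /neighborsP[v vY vw]; rewrite inE.
  apply/negP => wI; have /forall_inP/(_ w (subsetP IY _ wI)) := iY v vY.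
  by rewrite vw.
have tS : t <= #|S|.
  have [y yY] := set0Pn _ Y0; apply: leq_trans G_min_degree _.
  apply: leq_trans (min_degree_le G y) _; apply: subset_leq_card.
  by apply/subsetP => w; rewrite inE => yw; apply/neighborsP; exists y.
have [st adjG] := sparse_extremal t_gt0 n_ge G_order G_connected G_eta NI SI cI (erefl _) tS.
apply: (alternating_tree V5 _ cI SI adjG).
by rewrite cI (leq_trans t_gt0).
Qed.
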